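(* For any integers $K,n$ satisfying $n\ge 2\log(K)$, the quadratic risk of the thresholded plug-in estimator $\overline F_\gamma$ is uniformly bounded over all $p\in\mathcal{P}_K$ as follows. 1) If $\gamma\in(0,1)$: $$\sup_{p\in\mathcal{P}_K}\mathbb{E}\left[(\overline F_\gamma-F_\gamma)^2\right]\lesssim_\gamma K^{2(1-\gamma)}\wedge\frac{K^2}{(\alpha^2 n)^\gamma}.$$ 2) If $\gamma>1$: $$\sup_{p\in\mathcal{P}_K}\mathbb{E}\left[(\overline F_\gamma-F_\gamma)^2\right]\lesssim_\gamma\left(\frac{(\log(Kn))^{\gamma-1}}{(\alpha^2 n)^{\gamma-1}}+\frac{1}{\alpha^2 n}\right)\wedge\left(\frac{K^2(\log(Kn))^\gamma}{(\alpha^2 n)^\gamma}+\frac{K^{3-2\gamma}\vee 1}{\alpha^2 n}\right).$$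
   Context: $K,n$ are positive integers, $[K]=\{1,\dots,K\}$, and the privacy level $\alpha\in(0,1)$ satisfies $\alpha^2 n\ge 1$. $\mathcal{P}_K=\{p\in[0,1]^K:\sum_{k=1}^K p_k=1\}$, and $F_\gamma=F_\gamma(p)=\sum_{k=1}^K p_k^\gamma$. Sensitive data are i.i.d. with $\mathbb{P}(x=k)=p_k$, $k\in[K]$. The Laplace non-interactive privacy mechanism applied to a datum $x_i$ releases $z_i=(z_{i1},\dots,z_{iK})$ with $z_{ik}=\mathbf{1}_{\{x_i=k\}}+\frac{\sigma}{\alpha}w_{ik}$, where $\sigma=2$ and the $w_{ik}$ are i.i.d. (over all individuals and all $k$) with density $\frac12e^{-|x|}$, independent of the data. $T_{[0,2]}[y]=(y\vee0)\wedge2$. $\tau=c/\sqrt{\alpha^2n}$ with $c\ge1$ a fixed numerical constant. Definition of $\overline F_\gamma$ for $\gamma\in(0,1)$: from $n$ data $x_1,\dots,x_n$ privatized by the Laplace non-interactive privacy mechanism, giving $z_{ik}=\mathbf{1}_{\{x_i=k\}}+\frac{\sigma}{\alpha}w_{ik}$, let $\hat z_k=\frac1n\sum_{i=1}^nz_{ik}$ and $\hat F_\gamma=\sum_{k=1}^K(T_{[0,2]}[\hat z_k])^\gamma$; then $\overline F_\gamma=\mathbf{1}_{\{K\le\tau^{-1}\}}\hat F_\gamma$. Definition of $\overline F_\gamma$ for $\gamma>1$: the sample size is $2n$, and the data are split in two samples $x^{(1)}=(x^{(1)}_1,\dots,x^{(1)}_n)$ and $x^{(2)}=(x^{(2)}_1,\dots,x^{(2)}_n)$,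 each privatized by the Laplace non-interactive privacy mechanism (independently), giving $z^{(s)}_{ik}=\mathbf{1}_{\{x^{(s)}_i=k\}}+\frac{\sigma}{\alpha}w^{(s)}_{ik}$, $s=1,2$, where the $w^{(s)}_{ik}$ are i.i.d. (over all $s,i,k$) with density $\frac12e^{-|x|}$, independent of the data. Let $\hat z^{(s)}_k=\frac1n\sum_{i=1}^nz^{(s)}_{ik}$ and $\hat\tau=192\,\sigma\sqrt{\frac{\log(Kn)}{\alpha^2n}}$. Then $$\overline F_\gamma=\sum_{k=1}^K\left(T_{[0,2]}\left[\hat z^{(2)}_k\cdot\mathbf{1}_{\{\hat z^{(1)}_k\ge\hat\tau\}}\right]\right)^\gamma.$$ $x\wedge y=\min\{x,y\}$, $x\vee y=\max\{x,y\}$; $x\lesssim_\gamma y$ means $x\le C_\gamma y$ for some constant $C_\gamma$ depending only on $\gamma$. *)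

(* Defs.v *)
From HB Require Import structures.
From mathcomp Require Import all_boot all_order all_algebra.
From mathcomp Require Import all_classical all_reals all_analysis.

Set Implicit Arguments.
Unset Strict Implicit.
Unset Printing Implicit Defensive.

Import Order.TTheory GRing.Theory Num.Theory.

Local Open Scope classical_set_scope.
Local Open Scope ring_scope.

Definition prob_simplex (R : realType) (K : nat) : set ('I_K -> R) :=
  [set p | (forall k, 0 <= p k <= 1) /\ \sum_(k < K) p k = 1].
Arguments prob_simplex : clear implicits.

Definition power_sum (R : realType) (K : nat) (gamma : R) (p : 'I_K -> R) : R :=
  \sum_(k < K) p k `^ gamma.

Definition laplace_pdf (R : realType) (u : R) : R := 2^-1 * expR (- `|u|).

Definition mutually_independent (d : measure_display) (T : measurableType d)
    (R : realType) (P : probability T R) (J : finType)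
    (F : J -> set (set T)) : Prop :=
  forall (S : {set J}) (A : J -> set T), (forall j, j \in S -> F j (A j)) ->
    (P (\bigcap_(j in [set` S]) A j) = \prod_(j in S) P (A j))%E.

(* The sigma-algebras generated by the data and by the noises; 'I_K carries the
   discrete sigma-algebra. *)
Definition sample_sigma (d : measure_display) (T : measurableType d)
    (R : realType) (K : nat) (I : finType)
    (x : I -> T -> 'I_K) (w : I -> 'I_K -> T -> R)
    (j : I + I * 'I_K) : set (set T) :=
  match j with
  | inl i => preimage_set_system setT (x i) setT
  | inr (i, k) => preimage_set_system setT (w i k) measurable
  end.

(* Under P, the x i are i.i.d. with law p, the w i k are i.i.d. Laplace, and the
   two families are independent: all these variables together are mutually
   independent. The finite type I indexes the individuals. *)
Record laplace_sample (d : measure_display) (T : measurableType d)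
    (R : realType) (K : nat) (I : finType) (P : probability T R)
    (p : 'I_K -> R) (x : I -> T -> 'I_K) (w : I -> 'I_K -> T -> R) : Prop :=
  LaplaceSample {
    data_measurable : forall i k, measurable (x i @^-1` [set k]) ;
    data_law : forall i k, P (x i @^-1` [set k]) = (p k)%:E ;
    noise_measurable : forall i k, measurable_fun setT (w i k) ;
    noise_law : forall i k (A : set R), measurable A ->
      (P (w i k @^-1` A) =
       \int[lebesgue_measure]_(u in A) (laplace_pdf u)%:E)%E ;
    sample_independent : mutually_independent P (sample_sigma x w)
  }.

Definition sigma_noise (R : realType) : R := 2.
Arguments sigma_noise : clear implicits.

Definition privatize (T : Type) (R : realType) (K : nat) (I : Type) (alpha : R)
    (x : I -> T -> 'I_K) (w : I -> 'I_K -> T -> R) (t : T)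
    (i : I) (k : 'I_K) : R :=
  (x i t == k)%:R + sigma_noise R / alpha * w i k t.

Definition trunc02 (R : realType) (y : R) : R := Num.min (Num.max y 0) 2.

Definition zhat (R : realType) (K n : nat) (z : 'I_n -> 'I_K -> R) (k : 'I_K) : R :=
  n%:R^-1 * \sum_(i < n) z i k.

Definition tau (R : realType) (c alpha : R) (n : nat) : R :=
  c / Num.sqrt (alpha ^+ 2 * n%:R).

Definition tauhat (R : realType) (alpha : R) (K n : nat) : R :=
  192 * sigma_noise R * Num.sqrt (ln (K * n)%:R / (alpha ^+ 2 * n%:R)).

Definition Fhat (R : realType) (K n : nat) (gamma : R)
    (z : 'I_n -> 'I_K -> R) : R :=
  \sum_(k < K) trunc02 (zhat z k) `^ gamma.

Definition Fbar_lt1 (R : realType) (K n : nat) (c alpha gamma : R)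
    (z : 'I_n -> 'I_K -> R) : R :=
  (K%:R <= (tau c alpha n)^-1)%R%:R * Fhat gamma z.

(* The individuals are indexed by 'I_2 * 'I_n: (s, i) is individual i of
   subsample s + 1. *)
Definition Fbar_gt1 (R : realType) (K n : nat) (alpha gamma : R)
    (z : 'I_2 * 'I_n -> 'I_K -> R) : R :=
  let zhat1 := zhat (fun i => z (ord0, i)) in
  let zhat2 := zhat (fun i => z (ord_max, i)) in
  \sum_(k < K)
    trunc02 (zhat2 k * (tauhat alpha K n <= zhat1 k)%R%:R) `^ gamma.

Definition quadratic_risk (d : measure_display) (T : measurableType d)
    (R : realType) (Z : Type) (P : probability T R) (z : T -> Z)
    (est : Z -> R) (theta : R) : \bar R :=
  ('E_P[(fun t => (est (z t) - theta) ^+ 2)%R])%E.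

(* Main.v *)
(** Write [N = alpha ^ 2 * n], [L = ln (K * n)], [delta = tauhat] and
    [Y k = zhat k - p k].

    Everything probabilistic comes from one exponential moment: the sample is an
    independent family, so [E exp (sum a k * Y k) <= exp (10 / N * sum a k ^ 2)]
    as long as [|a k| <= n * alpha / 4]. It gives both
    [E (sum a k * Y k) ^ 2 <~ sum a k ^ 2 / N] and, since [n >= 2 ln K] forces
    [L <= n], the tail [P (|Y k| > delta / 2) <~ (K * n) ^ -47].

    For [gamma < 1], [|u ^ gamma - v ^ gamma| <= |u - v| ^ gamma] and the second
    moment of [Y k] suffice, with [F <~ K ^ (1 - gamma)] when the estimator is
    cut to [0].

    For [gamma > 1], work on the event where both subsamples have all
    [|Y k| <= delta / 2]; its complement is negligible even against the crude
    bound [(2 ^ gamma * K) ^ 2]. A coordinate with [p k < 3 / 2 * delta] then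
    contributes at most [(2 * p k) ^ gamma], whichever way the threshold
    decides; one with [p k >= 3 / 2 * delta] is kept, its truncation is
    inactive, and it contributes [gamma * p k ^ (gamma - 1) * Y k] up to
    [p k ^ (gamma - 2) * Y k ^ 2]. Since thresholding is deterministic on this
    event, the independence between the subsamples plays no role. Bounding the
    powers of [p k] by means of [sum p k = 1] gives the first rate, bounding
    them by powers of [delta] coordinate by coordinate gives the second. The
    linear term is [O(1 / N)] if [gamma >= 2]; if [gamma < 2], it is absorbed by
    [delta ^ (gamma - 1)] in the first rate, and in the second one its second
    moment is [sum p k ^ (2 * gamma - 2) / N]. *)

Require Import Defs.
From HB Require Import structures.
From mathcomp Require Import all_boot all_order all_algebra.
From mathcomp Require Import all_classical all_reals all_analysis.
From mathcomp Require Import measurable_realfun ring lra.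


Set Implicit Arguments.
Unset Strict Implicit.
Unset Printing Implicit Defensive.

Import Order.TTheory GRing.Theory Num.Theory.

Local Open Scope classical_set_scope.
Local Open Scope ring_scope.

(** * Integration of nonnegative functions and independence *)

Section nonnegative_integration.
Local Open Scope ereal_scope.
Context d (T : measurableType d) (R : realType).
Implicit Types (mu nu : {measure set T -> \bar R}).

Import HBNNSimple.

(* Unlike [ge0_le_integral], no measurability is required: the integral of a
   nonnegative function is a supremum over the simple functions below it. *)
Lemma ge0_le_integralT mu (f g : T -> \bar R) :
  (forall t, 0 <= f t) -> (forall t, f t <= g t) ->
  \int[mu]_t f t <= \int[mu]_t g t.
Proof.
move=> f0 fg; rewrite !ge0_integralTE//; last first.
  by move=> t; exact: le_trans (fg t).
apply: ereal_sup_le => _ [h hf <-]; exists h => // t.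
exact: le_trans (hf t) (fg t).
Qed.

(** Both sides are limits along the same nondecreasing simple functions approximating [f]; on an
    indicator the identity is the hypothesis on [nu]. *)
Lemma ge0_integral_density mu nu (h : T -> R) :
  measurable_fun setT h -> (forall t, 0 <= h t)%R ->
  (forall A, measurable A -> nu A = \int[mu]_(t in A) (h t)%:E) ->
  forall f : T -> \bar R, measurable_fun [set: T] f -> (forall t, 0 <= f t) ->
  \int[nu]_t f t = \int[mu]_t (f t * (h t)%:E).
Proof.
move=> mh h0 nuE f mf f0.
have mhE : measurable_fun setT (EFin \o h) by exact/measurable_EFinP.
pose f_ := nnsfun_approx measurableT mf.
transitivity (lim (\int[nu]_x (f_ n x)%:E @[n --> \oo])).
  rewrite -monotone_convergence//=.
  - apply: eq_integral => ? /[!inE] xD; apply/esym/cvg_lim => //=.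
    exact: cvg_nnsfun_approx.
  - by move=> n; exact/measurable_EFinP/measurable_funTS.
  - by move=> n ? _; rewrite lee_fin.
  - by move=> ? _ ? ? mn; rewrite lee_fin; exact/lefP/nd_nnsfun_approx.
transitivity (lim (\int[mu]_x ((f_ n x)%:E * (h x)%:E) @[n --> \oo])); last first.
  rewrite -monotone_convergence//=.
  - apply: eq_integral => x _; apply/cvg_lim => //=.
    by apply: cvgeZr => //; exact: cvg_nnsfun_approx.
  - move=> n; apply: emeasurable_funM => //.
    exact/measurable_EFinP/measurable_funTS.
  - by move=> n ? _; rewrite mule_ge0// lee_fin.
  - move=> ? _ ? ? mn; rewrite lee_wpmul2r ?lee_fin//.
    exact/lefP/nd_nnsfun_approx.
suff suf n : \int[nu]_x (f_ n x)%:E = \int[mu]_x ((f_ n x)%:E * (h x)%:E).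
  by under eq_fun do rewrite suf.
have mi r : measurable_fun setT (fun x => (r * \1_(f_ n @^-1` [set r]) x)%:E).
  by apply: (measurable_comp measurableT) => //; exact: measurable_funM.
transitivity (\int[nu]_x
    (\sum_(y \in range (f_ n)) (y * \1_(f_ n @^-1` [set y]) x)%:E)).
  by apply: eq_integral => t tE; rewrite /= fimfunE -fsumEFin.
rewrite ge0_integral_fsum//; last by move=> m y Ey; exact: nnfun_muleindic_ge0.
transitivity (\int[mu]_x (\sum_(y \in range (f_ n))
    (y * \1_(f_ n @^-1` [set y]) x)%:E * (h x)%:E)); last first.
  apply: eq_integral => x _.
  rewrite -ge0_mule_fsuml => [|y]; last exact: nnfun_muleindic_ge0.
  by rewrite fsumEFin // -(fimfunE _ x).
rewrite ge0_integral_fsum//; last 2 first.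
  - by move=> y; exact: emeasurable_funM.
  - by move=> m y Ey; rewrite mule_ge0 ?lee_fin// -lee_fin nnfun_muleindic_ge0.
apply: eq_fsbigr => r rhn.
under eq_integral do rewrite EFinM.
rewrite integralZl_indic_nnsfun//.
under [RHS]eq_integral do rewrite EFinM -muleA.
rewrite ge0_integralZl//.
- under [in RHS]eq_integral do rewrite muleC.
  rewrite [in RHS](eq_integral ((EFin \o h) \_ (f_ n @^-1` [set r]))); last first.
    by move=> x xE; rewrite epatch_indic.
  by rewrite -integral_mkcond -nuE// integral_indic// setIT.
- by apply: emeasurable_funM => //; exact/measurable_EFinP.
- by move=> t Et; rewrite mule_ge0 ?lee_fin.
- by move: rhn; rewrite inE => -[t _ <-]; rewrite lee_fin.
Qed.

End nonnegative_integration.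

(** The mean of a nonnegative function depends only on its law: both integrals are transported to
    the image measure, restricted to the half-line where the identity is nonnegative. *)
Lemma eq_integral_preimage d1 d2 (T1 : measurableType d1)
    (T2 : measurableType d2) (R : realType) (mu1 : {measure set T1 -> \bar R})
    (mu2 : {measure set T2 -> \bar R}) (g1 : T1 -> R) (g2 : T2 -> R) :
  measurable_fun [set: T1] g1 -> (forall t, 0 <= g1 t) ->
  measurable_fun [set: T2] g2 -> (forall t, 0 <= g2 t) ->
  (forall B : set R, measurable B -> mu1 (g1 @^-1` B) = mu2 (g2 @^-1` B)) ->
  (\int[mu1]_t (g1 t)%:E = \int[mu2]_t (g2 t)%:E)%E.
Proof.
move=> mg1 g10 mg2 g20 mu12.
have D0 : measurable (`[0%R, +oo[%classic : set R) by [].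
have mEf : measurable_fun (`[0%R, +oo[%classic : set R) (EFin : R -> \bar R).
  exact/measurable_EFinP.
have gD T (g : T -> R) : (forall t, 0 <= g t) -> g @^-1` `[0%R, +oo[%classic = setT.
  by move=> g0; apply/seteqP; split => t //= _; rewrite in_itv/= g0.
have pos : {in (`[0%R, +oo[%classic : set R), forall y : R, (0 <= y%:E)%E}.
  by move=> y; rewrite inE/= in_itv/= andbT lee_fin.
have := ge0_integral_pushforward mg1 mu1 D0 mEf pos.
have := ge0_integral_pushforward mg2 mu2 D0 mEf pos.
rewrite !gD// => <- <-.
by apply: eq_measure_integral => //= B mB _; exact: mu12.
Qed.

Section density.
Local Open Scope ereal_scope.
Context d (T : measurableType d) (R : realType).
Variables (mu : {measure set T -> \bar R}) (h : T -> R).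
Hypotheses (mh : measurable_fun setT h) (h0 : forall t, (0 <= h t)%R).

Definition density_measure of measurable_fun setT h &
    (forall t, (0 <= h t)%R) :=
  fun A : set T => \int[mu]_(t in A) (h t)%:E.

Local Notation nu := (density_measure mh h0).

Let nu0 : nu set0 = 0.
Proof. by rewrite /density_measure integral_set0. Qed.

Let nu_ge0 A : 0 <= nu A.
Proof. by apply: integral_ge0 => t _; rewrite lee_fin. Qed.

Let nu_sigma_additive : semi_sigma_additive nu.
Proof.
move=> /= F mF tF mUF; rewrite /density_measure; apply: cvg_toP.
  apply: ereal_nondecreasing_is_cvgn => m n mn.
  apply: lee_sum_nneg_natr => // k _ _; apply: integral_ge0 => /= x Fkx.
  by rewrite lee_fin.
rewrite ge0_integral_bigcup//=.
- by apply/measurable_funTS; exact/measurable_EFinP.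
- by move=> x _; rewrite lee_fin.
Qed.

HB.instance Definition _ := isMeasure.Build _ _ _ nu
  nu0 nu_ge0 nu_sigma_additive.

End density.

(** * Mean of a product of independent nonnegative functions *)

Section product_of_expectations.
Local Open Scope ereal_scope.
Context d (T : measurableType d) (R : realType) (P : probability T R).

(** The last hypothesis says that [g] has the same law under the measure of density [h] as under
    [c * P], so its integrals under both agree. *)
Lemma integral_indep_mul (g h : T -> R) (c : R) :
  measurable_fun setT g -> (forall t, 0 <= g t)%R ->
  measurable_fun setT h -> (forall t, 0 <= h t)%R -> (0 <= c)%R ->
  (forall B : set R, measurable B ->
     \int[P]_(t in g @^-1` B) (h t)%:E = c%:E * P (g @^-1` B)) ->
  \int[P]_t (g t * h t)%:E = c%:E * \int[P]_t (g t)%:E.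
Proof.
move=> mg g0 mh h0 c0 gh.
pose nu : {measure set T -> \bar R} := density_measure P mh h0.
have mgE : measurable_fun setT (EFin \o g) by exact/measurable_EFinP.
rewrite -[LHS](@ge0_integral_density _ _ _ P nu h mh h0 _ (EFin \o g))//.
rewrite (@eq_integral_preimage _ _ _ _ _ nu (mscale (NngNum c0) P) g g)//.
by rewrite ge0_integral_mscale// => t _; rewrite lee_fin.
Qed.

Lemma integral_prod_indep (J : finType) (F : J -> set (set T)) (g : J -> T -> R) :
  mutually_independent P F -> (forall j A, F j A -> measurable A) ->
  (forall j (B : set R), measurable B -> F j (g j @^-1` B)) ->
  (forall j t, 0 <= g j t)%R -> (forall j, \int[P]_t (g j t)%:E < +oo) ->
  \int[P]_t (\prod_j g j t)%:E = \prod_j \int[P]_t (g j t)%:E.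
Proof.
move=> indF mF Fg g0 gfin.
have mg j : measurable_fun setT (g j).
  by move=> _ B mB; rewrite setTI; apply: (mF j); exact: Fg.
(* Indicators are replaced by the functions [g j] one index at a time: [s] lists the indices already
   treated, the others carry arbitrary events. The empty list is the definition of independence. *)
pose u (s : seq J) (A : J -> set T) j := if j \in s then g j else \1_(A j).
have u0 s A j t : (0 <= u s A j t)%R by rewrite /u; case: ifP => // _; rewrite indicE.
have mu s A j : (forall j, F j (A j)) -> measurable_fun setT (u s A j).
  by move=> FA; rewrite /u; case: ifP => // _; exact/measurable_indic/(mF j).
have ufin s A j : (forall j, F j (A j)) -> \int[P]_t (u s A j t)%:E < +oo.
  move=> FA; rewrite /u; case: ifP => // _.
  rewrite integral_indic//; last exact: (mF j).
  by rewrite setIT (le_lt_trans (probability_le1 _ _)) ?ltry//; exact: (mF j).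
have FT j : F j setT by have := Fg j setT measurableT; rewrite preimage_setT.
suff key s A : (forall j, F j (A j)) ->
    \int[P]_t (\prod_j u s A j t)%:E = \prod_j \int[P]_t (u s A j t)%:E.
  have := key (enum J) (fun=> setT) FT.
  rewrite (eq_bigr (fun j => \int[P]_t (g j t)%:E)); last first.
    by move=> j _; apply: eq_integral => t _; rewrite /u mem_enum.
  move=> <-; apply: eq_integral => t _; congr EFin.
  by apply: eq_bigr => j _; rewrite /u mem_enum.
elim: s A => [A FA|j0 s IH A FA].
  transitivity (\int[P]_t (\1_(\bigcap_(j in [set` [set: J]%SET]) A j) t : R)%:E).
    apply: eq_integral => t _; congr EFin; rewrite indicE /u.
    have [Ht|Ht] := pselect ((\bigcap_(j in [set` [set: J]%SET]) A j) t).
      rewrite mem_set// big1// => j _; rewrite indicE mem_set//.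
      by apply: Ht; rewrite /= finset.in_setT.
    rewrite memNset//; have [j nj] : exists j, ~ A j t.
      apply: contrapT => H; apply: Ht => j _; apply: contrapT => nj.
      by apply: H; exists j.
    by rewrite (bigD1 j)//= indicE memNset// mul0r.
  have mA j : measurable (A j) by exact: (mF j).
  rewrite integral_indic//; last first.
    by apply: fin_bigcap_measurable => //; exact: finite_finset.
  rewrite setIT; apply: etrans (indF [set: J]%SET A (fun j _ => FA j)) _.
  rewrite (eq_bigl xpredT); last by move=> j; rewrite finset.in_setT.
  by apply: eq_bigr => j _; rewrite /u/= integral_indic// setIT.
have [j0s|j0s] := boolP (j0 \in s).
  have uE j : u (j0 :: s) A j = u s A j.
    by rewrite /u inE; case: eqP => // ->; rewrite j0s.
  by under eq_integral do under eq_bigr do rewrite uE; rewrite IH//; under [RHS]eq_bigr do rewrite uE.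
pose h t : R := (\prod_(j | j != j0) u s A j t)%R.
have uE j : j != j0 -> u (j0 :: s) A j = u s A j.
  by rewrite /u inE => /negbTE ->.
have u0E : u (j0 :: s) A j0 = g j0 by rewrite /u inE eqxx.
have mh : measurable_fun setT h.
  rewrite /h; under eq_fun do rewrite -big_filter.
  by apply: measurable_prod => j _; exact: mu.
have h0 t : (0 <= h t)%R by exact: prodr_ge0.
(* Since the induction hypothesis holds for all events, the one at [j0] can be any [B]; preimages
   under [g j0] then give what [integral_indep_mul] asks. *)
have IHB B : F j0 B -> \int[P]_(t in B) (h t)%:E =
    \prod_(j | j != j0) \int[P]_t (u s A j t)%:E * P B.
  move=> FB; pose A' j := if j == j0 then B else A j.
  have FA' j : F j (A' j) by rewrite /A'; case: eqP => // ->.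
  have uA' j : j != j0 -> u s A' j = u s A j.
    by rewrite /u /A' => /negbTE ->.
  have uj0 : u s A' j0 = \1_B by rewrite /u /A' eqxx (negbTE j0s).
  have := IH A' FA'; rewrite (bigD1 j0)//= uj0.
  rewrite (eq_bigr (fun j => \int[P]_t (u s A j t)%:E)); last first.
    by move=> j jj0; rewrite uA'.
  rewrite integral_indic//; last exact: (mF j0).
  rewrite setIT muleC => <-.
  rewrite [LHS]integral_mkcond; apply: eq_integral => t _.
  rewrite (bigD1 j0)//= uj0 epatch_indic/= -EFinM mulrC; congr (_ * _)%:E.
  by apply: eq_bigr => j jj0; rewrite uA'.
pose c := fine (\prod_(j | j != j0) \int[P]_t (u s A j t)%:E).
have cE : \prod_(j | j != j0) \int[P]_t (u s A j t)%:E = c%:E.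
  rewrite fineK//; apply: prode_fin_num => j _.
  rewrite ge0_fin_numE ?ufin// integral_ge0// => t _; rewrite lee_fin//.
have c0 : (0 <= c)%R.
  rewrite -lee_fin -cE; apply: prode_ge0 => j _.
  by rewrite integral_ge0// => t _; rewrite lee_fin.
rewrite (bigD1 j0)//= u0E muleC.
under [in RHS]eq_bigr => j jj0 do rewrite uE//.
rewrite cE -(@integral_indep_mul (g j0) h)//.
  apply: eq_integral => t _; congr EFin; rewrite (bigD1 j0)//= u0E; congr (_ * _)%R.
  by apply: eq_bigr => j jj0; rewrite uE.
by move=> B mB; rewrite IHB ?cE//; exact: Fg.
Qed.

End product_of_expectations.

(** * Exponential moments of a privatized sample *)

Section laplace.
Context (R : realType).
Local Notation mu := (@lebesgue_measure R).

Lemma ge0_integral_oppr (f : R -> \bar R) :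
  measurable_fun [set: R] f -> (forall x, 0 <= f x)%E ->
  (\int[mu]_x f (- x)%R = \int[mu]_x f x)%E.
Proof.
move=> mf f0.
have mN : measurable_fun [set: measurableTypeR R] (-%R : R -> measurableTypeR R).
  exact: oppr_measurable.
have := ge0_integral_pushforward mN mu measurableT mf (fun y _ => f0 y).
rewrite preimage_setT => <-.
by apply: eq_measure_integral => //= A mA _; exact: lebesgue_measureN.
Qed.

Lemma measurable_laplace_pdf : measurable_fun [set: R] (@laplace_pdf R).
Proof.
apply: measurable_funM => //; apply: measurableT_comp => //.
by apply: measurableT_comp => //; exact: measurable_normr.
Qed.

Lemma laplace_pdf_ge0 (x : R) : 0 <= laplace_pdf x.
Proof. by rewrite mulr_ge0// ?invr_ge0// expR_ge0. Qed.

(* The two half-lines are compared with exponential densities of rates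
   [1 - u] and [1 + u]; the total mass is [1 / (1 - u ^+ 2)]. *)
Lemma laplace_mgf (u : R) : u ^+ 2 <= 2^-1 ->
  (\int[mu]_x ((expR (u * x))%:E * (laplace_pdf x)%:E) <=
   (expR (2 * u ^+ 2))%:E)%E.
Proof.
move=> u2.
have u1 : 0 < 1 - u by nra.
have u1' : 0 < 1 + u by nra.
pose a := (2 * (1 - u))^-1; pose b := (2 * (1 + u))^-1.
have a0 : 0 <= a by rewrite invr_ge0 mulr_ge0// ltW.
have b0 : 0 <= b by rewrite invr_ge0 mulr_ge0// ltW.
have mE r : measurable_fun [set: R] (fun x => (exponential_pdf r x)%:E).
  by apply/measurable_EFinP; exact: measurable_exponential_pdf.
have mEN r : measurable_fun [set: R] (fun x => (exponential_pdf r (- x))%:E).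
  apply/measurable_EFinP; apply: measurableT_comp.
    exact: measurable_exponential_pdf.
  exact: oppr_measurable.
have E0 r x : 0 < r -> (0 <= (exponential_pdf r x)%:E)%E.
  by move=> r0; rewrite lee_fin exponential_pdf_ge0// ltW.
have le_exp : (\int[mu]_x ((expR (u * x))%:E * (laplace_pdf x)%:E) <=
    \int[mu]_x (a%:E * (exponential_pdf (1 - u) x)%:E +
                b%:E * (exponential_pdf (1 + u) (- x))%:E))%E.
  apply: ge0_le_integralT => x; rewrite -!EFinM.
    by rewrite lee_fin mulr_ge0// ?expR_ge0// laplace_pdf_ge0.
  rewrite -EFinD lee_fin /laplace_pdf.
  have [x0|x0] := leP 0 x.
    rewrite exponential_pdfE// ger0_norm//.
    rewrite (_ : expR (u * x) * (2^-1 * expR (- x)) = a * ((1 - u) * expR (- (1 - u) * x))); last first.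
      have -> : - (1 - u) * x = u * x - x by ring.
      rewrite expRD /a; field; lra.
    rewrite lerDl mulr_ge0// exponential_pdf_ge0//; lra.
  rewrite [X in _ + _ * X]exponential_pdfE; last lra.
  rewrite ltr0_norm//.
  rewrite (_ : expR (u * x) * (2^-1 * expR (- - x)) = b * ((1 + u) * expR (- (1 + u) * - x))); last first.
    have -> : - (1 + u) * - x = u * x - - x by ring.
    rewrite expRD /b; field; lra.
  rewrite lerDr mulr_ge0// exponential_pdf_ge0//; lra.
apply: (le_trans le_exp); rewrite ge0_integralD//; first last.
  - apply: measurable_funeM; exact: mEN.
  - by move=> x _; rewrite mule_ge0//; exact: E0.
  - apply: measurable_funeM; exact: mE.
  - by move=> x _; rewrite mule_ge0//; exact: E0.
rewrite !ge0_integralZl_EFin//; first last.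
  - exact: mE.
  - by move=> x _; exact: E0.
  - exact: mEN.
  - by move=> x _; exact: E0.
rewrite (@ge0_integral_oppr (fun x => (exponential_pdf (1 + u) x)%:E))//; last first.
  by move=> x; exact: E0.
rewrite !integral_exponential_pdf// !mule1 -EFinD lee_fin.
(* With [v = u ^ 2 <= 1 / 2], [(1 - v) * (1 + 2 * v) = 1 + v * (1 - 2 * v) >= 1]. *)
apply: (@le_trans _ _ (1 + 2 * u ^+ 2)); last exact: expR_ge1Dx.
rewrite (_ : a + b = (1 - u ^+ 2)^-1); last by rewrite /a /b; field; nra.
have h : 0 < 1 - u ^+ 2 by lra.
rewrite -[leLHS]mul1r ler_pdivrMr//; nra.
Qed.

Lemma laplace_law_mgf d (T : measurableType d) (P : probability T R)
    (W : T -> R) (u : R) :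
  measurable_fun [set: T] W ->
  (forall A : set R, measurable A ->
    (P (W @^-1` A) = \int[mu]_(x in A) (laplace_pdf x)%:E)%E) ->
  u ^+ 2 <= 2^-1 ->
  (\int[P]_t (expR (u * W t))%:E <= (expR (2 * u ^+ 2))%:E)%E.
Proof.
move=> mW lawW u2; apply: le_trans (laplace_mgf u2).
have mf : measurable_fun [set: R] (fun x => expR (u * x)).
  by apply: measurableT_comp.
pose law : {measure set (measurableTypeR R) -> \bar R} :=
  density_measure mu measurable_laplace_pdf laplace_pdf_ge0.
rewrite (@eq_integral_preimage _ _ _ _ _ _ law _ (fun x => expR (u * x))); first last.
- by move=> B mB; apply: lawW; rewrite -[X in measurable X]setTI; exact: mf.
- by move=> x; exact: expR_ge0.
- exact: mf.
- by move=> t; exact: expR_ge0.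
- by apply: measurableT_comp => //; exact: measurable_funM.
rewrite (@ge0_integral_density _ _ _ mu law (@laplace_pdf R))//.
- exact: measurable_laplace_pdf.
- exact: laplace_pdf_ge0.
- exact/measurable_EFinP.
Qed.

End laplace.

(** Measurability and sign are bundled with the upper bound, so that such bounds can be added,
    scaled and multiplied without reproving the side conditions. *)
Definition mean_le d (T : measurableType d) (R : realType)
    (P : probability T R) (f : T -> R) (b : R) : Prop :=
  [/\ measurable_fun [set: T] f, forall t, 0 <= f t
    & (\int[P]_t (f t)%:E <= b%:E)%E].

Section mean_le.
Context d (T : measurableType d) (R : realType) (P : probability T R).
Implicit Types (f g : T -> R) (b c : R).

Lemma mean_le_cst c : 0 <= c -> mean_le P (fun=> c) c.
Proof.
move=> c0; split => //.
by rewrite integral_cst//= [X in (_ * X)%E]probability_setT mule1.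
Qed.

Lemma mean_leD f g b c :
  mean_le P f b -> mean_le P g c -> mean_le P (fun t => f t + g t) (b + c).
Proof.
move=> [mf f0 fb] [mg g0 gc]; split.
- exact: measurable_funD.
- by move=> t; rewrite addr_ge0.
under eq_integral do rewrite EFinD.
rewrite ge0_integralD//; first by rewrite EFinD leeD.
- by move=> t _; rewrite lee_fin.
- exact/measurable_EFinP.
- by move=> t _; rewrite lee_fin.
- exact/measurable_EFinP.
Qed.

Lemma mean_leZ f b c : 0 <= c -> mean_le P f b ->
  mean_le P (fun t => c * f t) (c * b).
Proof.
move=> c0 [mf f0 fb]; split.
- exact: measurable_funM.
- by move=> t; rewrite mulr_ge0.
under eq_integral do rewrite EFinM.
rewrite ge0_integralZl_EFin//; first by rewrite EFinM lee_wpmul2l.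
- by move=> t _; rewrite lee_fin.
- exact/measurable_EFinP.
Qed.

Lemma mean_le_sum (I : Type) (s : seq I) (f : I -> T -> R) (b : I -> R) :
  (forall i, mean_le P (f i) (b i)) ->
  mean_le P (fun t => \sum_(i <- s) f i t) (\sum_(i <- s) b i).
Proof.
move=> fb; elim: s => [|i s ih].
  rewrite big_nil; under [X in mean_le _ X]eq_fun do rewrite big_nil.
  exact: mean_le_cst.
rewrite big_cons; under [X in mean_le _ X]eq_fun do rewrite big_cons.
exact: mean_leD.
Qed.

Lemma mean_le_le f g b c : measurable_fun [set: T] f -> (forall t, 0 <= f t) ->
  (forall t, f t <= g t) -> b <= c -> mean_le P g b -> mean_le P f c.
Proof.
move=> mf f0 fg bc [mg g0 gb]; split => //.
apply: (@le_trans _ _ b%:E); last by rewrite lee_fin.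
apply: le_trans gb; apply: ge0_le_integralT => t; first by rewrite lee_fin.
by rewrite lee_fin.
Qed.

(** Meant for [f] the loss and [g] an explicit majorant of it. *)
Lemma integral_le_mean f g b : (forall t, 0 <= f t) -> (forall t, f t <= g t) ->
  mean_le P g b -> (\int[P]_t (f t)%:E <= b%:E)%E.
Proof.
move=> f0 fg [_ _ gb]; apply: le_trans gb.
by apply: ge0_le_integralT => t; rewrite lee_fin.
Qed.

Lemma mean_le_prod (J : finType) (F : J -> set (set T)) (g : J -> T -> R)
    (b : J -> R) :
  mutually_independent P F -> (forall j A, F j A -> measurable A) ->
  (forall j (B : set R), measurable B -> F j (g j @^-1` B)) ->
  (forall j, mean_le P (g j) (b j)) ->
  mean_le P (fun t => \prod_j g j t) (\prod_j b j).
Proof.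
move=> indF mF Fg gb.
have g0 j t : 0 <= g j t by have [_ ->] := gb j.
split.
- by apply: measurable_prod => j _; have [] := gb j.
- by move=> t; exact: prodr_ge0.
rewrite (integral_prod_indep indF mF Fg)//; last first.
  by move=> j; have [_ _ /le_lt_trans->//] := gb j; rewrite ltry.
have E0 j : (0 <= \int[P]_t (g j t)%:E)%E.
  by apply: integral_ge0 => t _; rewrite lee_fin.
rewrite -prodEFin.
suff : (0 <= \prod_j \int[P]_t (g j t)%:E <= \prod_j (b j)%:E)%E by case/andP.
elim/big_ind2: _ => [|x1 x2 y1 y2 /andP[x0 xx] /andP[y0 yy]|j _].
- by rewrite lee01 lexx.
- by rewrite mule_ge0//= lee_pmul.
- by rewrite E0; have [] := gb j.
Qed.

End mean_le.

Section exponential_inequalities.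
Context (R : realType).
Implicit Types u : R.

(** Inverting [1 - u <= exp (- u)] gives [exp u <= 1 / (1 - u)], and [(1 + u + 2 * u ^ 2) * (1 - u)
    = 1 + u ^ 2 * (1 - 2 * u)]. *)
Lemma expR_le_quadratic u : u <= 2^-1 -> expR u <= 1 + u + 2 * u ^+ 2.
Proof.
move=> u2; have := expR_ge1Dx (- u); rewrite expRN => h.
have u1 : 0 < 1 - u by lra.
apply: (@le_trans _ _ (1 - u)^-1).
  by rewrite -[leLHS]invrK lef_pV2// posrE invr_gt0 expR_gt0.
rewrite -[leLHS]mul1r ler_pdivrMr//; nra.
Qed.

Lemma sqr_le_expRD u : u ^+ 2 <= 2 * (expR u + expR (- u)).
Proof.
have h (v : R) : 0 <= v -> v ^+ 2 <= 2 * (expR v + expR (- v)).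
  move=> v0; have := expR_ge1Dxn 1 v0; rewrite !factS fact0.
  by have := expR_ge0 (- v); lra.
have [/h//|/ltW u0] := leP 0 u.
have := h (- u); rewrite opprK sqrrN addrC; apply; lra.
Qed.

(** Contribution of one datum. The bound [1 / 4] keeps the centered values below [1 / 2], where the
    quadratic bound on [exp] applies; the linear term vanishes by centering and the variance is at
    most the sum of the [a k ^ 2]. *)
Lemma centered_mgf (K : nat) (p a : 'I_K -> R) : prob_simplex R K p ->
  (forall k, `|a k| <= 4^-1) ->
  \sum_k p k * expR (a k - \sum_l p l * a l) <= expR (2 * \sum_k a k ^+ 2).
Proof.
move=> [p01 p1] a4; set m := \sum_l p l * a l.
have p0 k : 0 <= p k by case/andP: (p01 k).
have m4 : `|m| <= 4^-1.
  apply: (le_trans (ler_norm_sum _ _ _)).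
  rewrite -[leRHS]mul1r -[X in X * _]p1 mulr_suml; apply: ler_sum => k _.
  by rewrite normrM ger0_norm// ler_wpM2l.
apply: (@le_trans _ _ (\sum_k p k * (1 + (a k - m) + 2 * (a k - m) ^+ 2))).
  apply: ler_sum => k _; rewrite ler_wpM2l// expR_le_quadratic//.
  move: m4 (a4 k); rewrite !ler_norml; lra.
have -> : \sum_k p k * (1 + (a k - m) + 2 * (a k - m) ^+ 2) =
    1 + 2 * (\sum_k p k * a k ^+ 2 - m ^+ 2).
  transitivity (\sum_k ((1 - m + 2 * m ^+ 2) * p k + (1 - 4 * m) * (p k * a k)
      + 2 * (p k * a k ^+ 2))).
    by apply: eq_bigr => k _; ring.
  rewrite !big_split/= -!mulr_sumr p1 -/m; ring.
apply: le_trans (expR_ge1Dx _); rewrite lerD2l ler_wpM2l// lerBlDr.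
apply: (@le_trans _ _ (\sum_k a k ^+ 2)); last by rewrite lerDl sqr_ge0.
apply: ler_sum => k _; rewrite -[leRHS]mul1r ler_wpM2r ?sqr_ge0//.
by case/andP: (p01 k).
Qed.

End exponential_inequalities.

Section laplace_sample.
Context d (T : measurableType d) (R : realType) (K : nat) (I : finType).
Variables (P : probability T R) (p : 'I_K -> R).
Variables (x : I -> T -> 'I_K) (w : I -> 'I_K -> T -> R).
Hypothesis sample : laplace_sample P p x w.

(** Serves to extract each of the two subsamples from the sample of size [2 * n]. *)
Lemma laplace_sample_inj (J : finType) (e : J -> I) : injective e ->
  laplace_sample P p (x \o e) (w \o e).
Proof.
move=> einj; case: sample => mx lx mw lw ind.
split => [i k|i k|i k|i k|] /=; [exact: mx|exact: lx|exact: mw|exact: lw|].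
pose f (j : J + J * 'I_K) : I + I * 'I_K :=
  match j with inl i => inl (e i) | inr ik => inr (e ik.1, ik.2) end.
have finj : injective f.
  by move=> [i|[i k]] [j|[j l]]//= [] => [/einj->//|/einj-> ->].
have sf j : sample_sigma (x \o e) (w \o e) j = sample_sigma x w (f j).
  by case: j => [i|[i k]].
move=> S A SA.
(* Transports the events along the injection [f]; the default [setT] is never met on the image of
   [S]. *)
pose B j := if [pick i | (i \in S) && (f i == j)] is Some i then A i else setT.
have Bf i : i \in S -> B (f i) = A i.
  rewrite /B => iS; case: pickP => [i' /andP[_ /eqP/finj->//]|/(_ i)].
  by rewrite iS eqxx.
have := ind (f @: S)%SET B; rewrite big_imset/=; last by move=> ? ? _ _ /finj.
have -> : \bigcap_(j in [set` (f @: S)%SET]) B j = \bigcap_(j in [set` S]) A j.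
  apply/seteqP; split => t h i /= iS.
    by rewrite -Bf//; apply: h; rewrite /= imset_f.
  by case/imsetP: iS => i' i'S ->; rewrite Bf//; exact: h.
move=> ->.
  by apply: eq_bigr => i iS; rewrite Bf.
by move=> j /imsetP[i iS ->]; rewrite Bf// -sf; exact: SA.
Qed.

Lemma measurable_data (i : I) (B : set 'I_K) : measurable (x i @^-1` B).
Proof.
have -> : x i @^-1` B = \bigcup_(k in B) (x i @^-1` [set k]).
  by apply/seteqP; split => [t Bt|t [k Bk /= ->]//]; exists (x i t).
apply: fin_bigcup_measurable => [|k _]; first exact: finite_finset.
exact: data_measurable sample i k.
Qed.

Lemma measurable_data_comp (i : I) (g : 'I_K -> R) :
  measurable_fun [set: T] (fun t => g (x i t)).
Proof.
move=> _ B mB; rewrite setTI.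
exact: (measurable_data i (g @^-1` B)).
Qed.

Lemma measurable_sample_sigma j A : sample_sigma x w j A -> measurable A.
Proof.
case: j => [i|[i k]] /= [B mB <-]; first by rewrite setTI; exact: measurable_data.
exact: noise_measurable sample i k _ _ mB.
Qed.

Lemma mean_data (i : I) (g : 'I_K -> R) : (forall k, 0 <= g k) ->
  mean_le P (fun t => g (x i t)) (\sum_k p k * g k).
Proof.
move=> g0; split => //; first exact: measurable_data_comp.
rewrite (eq_integral (fun t => \sum_k (g k)%:E * (\1_(x i @^-1` [set k]) t)%:E))%E;
    last first.
  move=> t _; rewrite (bigD1 (x i t))//= indicE mem_set// mule1 big1 ?adde0//.
  by move=> k kx; rewrite indicE memNset ?mule0//= => /esym/eqP; rewrite (negbTE kx).
rewrite ge0_integral_sum//; last 2 first.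
- move=> k; apply: measurable_funeM; apply/measurable_EFinP.
  by apply: measurable_indic; exact: data_measurable sample i k.
- by move=> k t _; rewrite mule_ge0// lee_fin.
rewrite -sumEFin; apply: lee_sum => k _.
have mk := data_measurable sample i k.
rewrite ge0_integralZl_EFin//; last first.
- exact/measurable_EFinP/measurable_indic.
rewrite integral_indic// setIT [X in (_ * X)%E](data_law sample i k) -EFinM mulrC.
exact: lexx.
Qed.

Variable alpha : R.
Hypotheses (p_simplex : prob_simplex R K p) (alpha01 : 0 < alpha < 1).

Lemma measurable_privatize i k :
  measurable_fun [set: T] (fun t => privatize alpha x w t i k).
Proof.
apply: measurable_funD; first exact: (measurable_data_comp i (fun l => (l == k)%:R)).
by apply: measurable_funM => //; exact: noise_measurable sample i k.
Qed.

(** The exponential splits into independent factors: one per individual, whose coordinates share the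
    same datum, and one per noise. The former cost [2 * a ^ 2] in the exponent, the latter
    [8 / alpha ^ 2 * a ^ 2], in total at most [10 / alpha ^ 2 * a ^ 2] as [alpha < 1]. The smallness
    of [a] puts each factor in the range of its bound. *)
Lemma privatize_mgf (a : I -> 'I_K -> R) :
  (forall i k, `|a i k| <= alpha / 4) ->
  mean_le P
    (fun t => expR (\sum_i \sum_k a i k * (privatize alpha x w t i k - p k)))
    (expR (10 / alpha ^+ 2 * \sum_i \sum_k a i k ^+ 2)).
Proof.
move=> a_small; have /andP[al0 al1] := alpha01.
pose m i := \sum_k p k * a i k.
pose g (j : I + I * 'I_K) t := match j with
  | inl i => expR (a i (x i t) - m i)
  | inr ik => expR (2 / alpha * a ik.1 ik.2 * w ik.1 ik.2 t) end.
pose b (j : I + I * 'I_K) := match j with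
  | inl i => expR (2 * \sum_k a i k ^+ 2)
  | inr ik => expR (2 * (2 / alpha * a ik.1 ik.2) ^+ 2) end.
have gb j : mean_le P (g j) (b j).
  case: j => [i|[i k]].
    have := mean_data i (fun k => expR_ge0 (a i k - m i)).
    case=> h1 h2 h3; split => //; apply: (le_trans h3).
    rewrite lee_fin; apply: centered_mgf => // k.
    by apply: (le_trans (a_small i k)); lra.
  split.
  - by apply: measurableT_comp => //; apply: measurable_funM => //; exact: noise_measurable sample i k.
  - by move=> t; exact: expR_ge0.
  apply: laplace_law_mgf; first exact: noise_measurable sample i k.
    exact: noise_law sample i k.
  rewrite exprMn; have : `|a i k| ^+ 2 <= (alpha / 4) ^+ 2.
    by rewrite ler_pXn2r ?nnegrE// divr_ge0// ltW.
  rewrite real_normK ?num_real// => h.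
  apply: (@le_trans _ _ ((2 / alpha) ^+ 2 * (alpha / 4) ^+ 2)).
    by rewrite ler_wpM2l// sqr_ge0.
  rewrite (_ : _ * _ = 4^-1); first lra.
  by field; rewrite gt_eqF.
have Fg j (B : set R) : measurable B -> sample_sigma x w j (g j @^-1` B).
  case: j => [i|[i k]] mB /=.
    by exists ((fun k => expR (a i k - m i)) @^-1` B) => //; rewrite setTI.
  exists ((fun y => expR (2 / alpha * a i k * y)) @^-1` B); last by rewrite setTI.
  rewrite -[X in measurable X]setTI.
  by have /(_ measurableT B mB) : measurable_fun [set: R] (fun y : R => expR (2 / alpha * a i k * y)) by apply: measurableT_comp.
have := mean_le_prod (sample_independent sample) measurable_sample_sigma Fg gb.
set F := fun t => expR _; have -> : (fun t => \prod_j g j t) = F.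
  apply/funext => t; rewrite big_sumType/= -(pair_bigA _ (fun i k => expR (2 / alpha * a i k * w i k t)))/=.
  rewrite -big_split/= /F expR_sum; apply: eq_bigr => i _.
  rewrite -expR_sum -expRD; congr expR.
  rewrite [RHS](eq_bigr (fun k => a i k * (x i t == k)%:R - p k * a i k +
     2 / alpha * a i k * w i k t)); last first.
    by move=> k _; rewrite /privatize /sigma_noise; ring.
  rewrite big_split sumrB/=; congr (_ - _ + _).
  rewrite (bigD1 (x i t))//= eqxx mulr1 big1 ?addr0// => k kx.
  by rewrite eq_sym (negbTE kx) mulr0.
case=> h1 h2 h3; split => //; apply: (le_trans h3); rewrite lee_fin.
rewrite big_sumType/= -(pair_bigA _ (fun i k => expR (2 * (2 / alpha * a i k) ^+ 2)))/=.
rewrite -big_split/= mulr_sumr expR_sum; apply: ler_prod => i _.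
apply/andP; split.
  by apply: mulr_ge0; [exact: expR_ge0|apply: prodr_ge0 => k _; exact: expR_ge0].
rewrite -expR_sum -expRD ler_expR.
have -> : \sum_k 2 * (2 / alpha * a i k) ^+ 2 = 8 / alpha ^+ 2 * \sum_k a i k ^+ 2.
  by rewrite mulr_sumr; apply: eq_bigr => k _; field; rewrite gt_eqF.
rewrite -mulrDl ler_wpM2r ?sumr_ge0//; first by move=> k _; exact: sqr_ge0.
have : 1 <= (alpha ^+ 2)^-1 by rewrite invr_ge1 ?exprn_gt0 ?unitfE ?gt_eqF ?exprn_gt0// expr_le1// ltW.
lra.
Qed.

End laplace_sample.

(** * Moments and tails of linear combinations of the errors *)

Section linear_statistics.
Context d (T : measurableType d) (R : realType) (K n : nat).
Variables (P : probability T R) (p : 'I_K -> R) (alpha : R).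
Variables (x : 'I_n -> T -> 'I_K) (w : 'I_n -> 'I_K -> T -> R).
Hypothesis sample : laplace_sample P p x w.
Hypotheses (p_simplex : prob_simplex R K p) (alpha01 : 0 < alpha < 1).
Hypothesis n_gt0 : (0 < n)%N.

Local Notation N := (alpha ^+ 2 * n%:R).
Local Notation err t k := (zhat (privatize alpha x w t) k - p k).

Let n0 : 0 < n%:R :> R. Proof. by rewrite ltr0n. Qed.
Let al0 : 0 < alpha. Proof. by case/andP: alpha01. Qed.
Let al1 : alpha < 1. Proof. by case/andP: alpha01. Qed.
Let N0 : 0 < N. Proof. by rewrite mulr_gt0// exprn_gt0. Qed.
Let bound_ge0 : 0 <= n%:R * alpha / 4.
Proof. by rewrite divr_ge0// mulr_ge0// ltW. Qed.

Lemma measurable_err k : measurable_fun [set: T] (fun t => err t k).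
Proof.
apply: measurable_funB => //; apply: measurable_funM => //.
by apply: measurable_sum => i; exact: measurable_privatize sample alpha i k.
Qed.

Lemma zhat_errE (t : T) k :
  err t k = \sum_(i < n) n%:R^-1 * (privatize alpha x w t i k - p k).
Proof.
rewrite -mulr_sumr sumrB mulrBr; congr (_ - _).
by rewrite sumr_const card_ord -[p k *+ n]mulr_natr mulrCA mulVf ?mulr1// gt_eqF.
Qed.

(** Each individual gets the weight [a k / n]; summing [n] equal squares leaves [a k ^ 2 / n]. *)
Lemma linear_mgf (a : 'I_K -> R) : (forall k, `|a k| <= n%:R * alpha / 4) ->
  mean_le P (fun t => expR (\sum_k a k * err t k))
    (expR (10 / N * \sum_k a k ^+ 2)).
Proof.
move=> a_small.
have := privatize_mgf sample p_simplex alpha01 (a := fun _ k => n%:R^-1 * a k).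
rewrite (_ : (fun t => expR _) = fun t => expR (\sum_k a k * err t k)); last first.
  apply/funext => t; rewrite exchange_big/=; congr expR; apply: eq_bigr => k _.
  by rewrite zhat_errE mulr_sumr; apply: eq_bigr => i _; ring.
rewrite (_ : 10 / alpha ^+ 2 * _ = 10 / N * \sum_k a k ^+ 2); last first.
  rewrite sumr_const card_ord -[X in _ * X]mulr_natr.
  under eq_bigr do rewrite exprMn.
  rewrite -mulr_sumr; field; rewrite !gt_eqF//.
apply=> i k; rewrite normrM (@ger0_norm _ n%:R^-1) ?invr_ge0 ?ler0n//.
rewrite ler_pdivrMl//; apply: le_trans (a_small k) _; lra.
Qed.

Lemma linear_sqr (a : 'I_K -> R) :
  mean_le P (fun t => (\sum_k a k * err t k) ^+ 2)
    (64 * expR 1 / N * \sum_k a k ^+ 2).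
Proof.
set A := \sum_k a k ^+ 2; set V := fun t => \sum_k a k * err t k.
have mV : measurable_fun [set: T] V.
  by apply: measurable_sum => k; apply: measurable_funM => //; exact: measurable_err.
have A0 : 0 <= A by apply: sumr_ge0 => k _; exact: sqr_ge0.
have aA k : a k ^+ 2 <= A.
  by rewrite /A (bigD1 k)//= lerDl sumr_ge0// => l _; exact: sqr_ge0.
have mV2 : measurable_fun [set: T] (fun t => V t ^+ 2) by exact: measurable_funX.
have [A_eq0|A_neq0] := eqVneq A 0.
  apply: (mean_le_le (g := fun=> 0) (b := 0)) => //.
  - by move=> t; exact: sqr_ge0.
  - move=> t; rewrite /V big1 ?expr0n// => k _.
    suff -> : a k = 0 by rewrite mul0r.
    by have := aA k; rewrite A_eq0 => h; apply/eqP; rewrite -sqrf_eq0 eq_le h sqr_ge0.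
  - by rewrite A_eq0 mulr0.
  - exact: mean_le_cst.
have A_gt0 : 0 < A by rewrite lt_neqAle eq_sym A_neq0.
(* The exponential moments at [s] and [- s] are at most [exp (10 / 16)], and [s] is admissible
   because [s ^ 2 * A = N / 16 <= n * N / 16]. Then [V ^ 2 = 16 * A / N * (s * V) ^ 2] is bounded by
   [sqr_le_expRD]. The case [A = 0] was set apart for this division. *)
pose s := Num.sqrt (N / A) / 4.
have s2 : s ^+ 2 = N / A / 16.
  by rewrite /s expr_div_n sqr_sqrtr ?divr_ge0 ?ltW//; congr (_ / _); ring.
have s0 : 0 < s by rewrite divr_gt0// sqrtr_gt0 divr_gt0.
have sV (r : R) : r ^+ 2 = s ^+ 2 -> mean_le P (fun t => expR (r * V t)) (expR 1).
  move=> rs.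
  have small k : `|r * a k| <= n%:R * alpha / 4.
    rewrite -ler_sqr ?nnegrE ?normr_ge0//.
    rewrite real_normK ?num_real// exprMn rs s2.
    apply: (@le_trans _ _ (N / A / 16 * A)).
      apply: ler_wpM2l => //; rewrite !divr_ge0//; exact: ltW.
    rewrite (_ : _ * A = N / 16); last by field; rewrite gt_eqF.
    rewrite (_ : (_ / 4) ^+ 2 = N * n%:R / 16); last by field.
    rewrite ler_pM2r ?invr_gt0// -[leLHS]mulr1 ler_pM2l//.
    by rewrite ler1n.
  have [h1 h2 h3] := linear_mgf small.
  have E t : \sum_k r * a k * err t k = r * V t.
    by rewrite /V mulr_sumr; apply: eq_bigr => k _; rewrite mulrA.
  split => [||].
  - by under eq_fun do rewrite -E.
  - by move=> t; exact: expR_ge0.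
  under eq_integral do rewrite -E.
  apply: (le_trans h3); rewrite lee_fin ler_expR.
  under eq_bigr do rewrite exprMn rs.
  rewrite -mulr_sumr -/A s2 (_ : _ * _ = 10 / 16); first lra.
  by field; rewrite !gt_eqF.
have := mean_leZ (c := 32 * (A / N)) _ (mean_leD (sV s erefl) (sV (- s) (sqrrN _))).
have A_N (r : R) : 0 <= r -> 0 <= r * (A / N).
  by move=> r0; rewrite mulr_ge0// divr_ge0// ltW.
move=> /(_ (A_N 32 (ler0n _ _))); apply: mean_le_le => //.
- by move=> t; exact: sqr_ge0.
- move=> t /=; rewrite mulNr.
  have := sqr_le_expRD (s * V t); rewrite exprMn s2 => h.
  rewrite (_ : V t ^+ 2 = 16 * (A / N) * (N / A / 16 * V t ^+ 2)); last first.
    by field; rewrite !gt_eqF.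
  apply: (@le_trans _ _ (16 * (A / N) * (2 * (expR (s * V t) + expR (- (s * V t)))))).
    by apply: ler_wpM2l => //; exact: A_N.
  by rewrite le_eqVlt; apply/orP; left; apply/eqP; ring.
- by rewrite le_eqVlt; apply/orP; left; apply/eqP; field; rewrite !gt_eqF.
Qed.

Let sum_delta (F : 'I_K -> R) k : \sum_l (l == k)%:R * F l = F k.
Proof.
rewrite (bigD1 k)//= eqxx mul1r big1 ?addr0// => l /negbTE->.
by rewrite mul0r.
Qed.

Lemma err_mgf k (s : R) : `|s| <= n%:R * alpha / 4 ->
  mean_le P (fun t => expR (s * err t k)) (expR (10 / N * s ^+ 2)).
Proof.
move=> s_small; have := @linear_mgf (fun l => (l == k)%:R * s).
rewrite (_ : (fun t => expR _) = fun t => expR (s * err t k)); last first.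
  apply/funext => t; congr expR; under eq_bigr do rewrite -mulrA.
  exact: sum_delta.
under eq_bigr do rewrite exprMn.
rewrite (_ : \sum_l _ = s ^+ 2); last first.
  by rewrite -[RHS](sum_delta (fun=> s ^+ 2) k); apply: eq_bigr => l _; case: eqP; rewrite ?expr1n ?expr0n.
by apply=> l; case: eqP => _; rewrite ?mul1r// mul0r normr0.
Qed.

Lemma err_sqr k : mean_le P (fun t => err t k ^+ 2) (64 * expR 1 / N).
Proof.
have := linear_sqr (fun l => (l == k)%:R).
rewrite (_ : (fun t => _ ^+ 2) = fun t => err t k ^+ 2); last first.
  by apply/funext => t; rewrite (sum_delta (fun l => err t l)).
rewrite (_ : \sum_l _ = 1) ?mulr1//.
by rewrite -[RHS](sum_delta (fun=> 1) k); apply: eq_bigr => l _; case: eqP; rewrite ?expr1n ?expr0n ?mulr1 ?mulr0.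
Qed.

(* Chernoff: [s] is the admissible exponent that makes [s * threshold]
   equal to [48 * l] while the mgf only costs [10 * l / 16]. *)
Definition tail_bound (l : R) (k : 'I_K) (t : T) : R :=
  let s := Num.sqrt (l * N) / 4 in
  expR (- (48 * l)) * (expR (s * err t k) + expR (- s * err t k)).

(** The condition [l <= n] is the admissibility of the exponent [s], as [s ^ 2 = l * N / 16]; each
    sign costs at most [exp l]. *)
Lemma mean_tail_bound l k : 0 <= l <= n%:R ->
  mean_le P (tail_bound l k) (2 * expR (- (47 * l))).
Proof.
move=> /andP[l0 ln]; pose s := Num.sqrt (l * N) / 4.
have s2 : s ^+ 2 = l * N / 16.
  have lN0 : 0 <= l * N by rewrite (mulr_ge0 l0) ?(ltW N0).
  by rewrite /s expr_div_n sqr_sqrtr//; field.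
have side (r : R) : r ^+ 2 = s ^+ 2 ->
    mean_le P (fun t => expR (r * err t k)) (expR l).
  move=> rs.
  have small : `|r| <= n%:R * alpha / 4.
    rewrite -ler_sqr ?nnegrE ?normr_ge0// real_normK ?num_real// rs s2.
    rewrite (_ : (_ / 4) ^+ 2 = n%:R * N / 16); last by field.
    by rewrite ler_pM2r ?invr_gt0// ler_pM2r.
  have [h1 h2 h3] := err_mgf k small.
  split => //; apply: (le_trans h3); rewrite lee_fin ler_expR rs s2.
  rewrite (_ : _ * _ = 10 / 16 * l); last by field; rewrite !gt_eqF.
  lra.
have := mean_leZ (expR_ge0 (- (48 * l))) (mean_leD (side s erefl) (side (- s) (sqrrN _))).
rewrite (_ : expR _ * _ = 2 * expR (- (47 * l)))// (_ : - (47 * l) = - (48 * l) + l); last by ring.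
by rewrite expRD; ring.
Qed.

Lemma tail_bound_ge0 l k t : 0 <= tail_bound l k t.
Proof. by rewrite mulr_ge0 ?addr_ge0 ?expR_ge0. Qed.

(** Pointwise Chernoff bound: [tail_bound] dominates the indicator of a large deviation, so its mean
    stands in for the probability. *)
Lemma tail_bound_ge1 l k t : 0 <= l ->
  192 * Num.sqrt (l / N) <= `|err t k| -> 1 <= tail_bound l k t.
Proof.
move=> l0 h; rewrite /tail_bound; set s := Num.sqrt (l * N) / 4.
have s0 : 0 <= s by rewrite divr_ge0 ?sqrtr_ge0.
have sl : 48 * l <= s * `|err t k|.
  apply: (@le_trans _ _ (s * (192 * Num.sqrt (l / N)))); last exact: ler_wpM2l.
  rewrite (_ : s * _ = 48 * (Num.sqrt (l * N) * Num.sqrt (l / N))); last first.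
    by rewrite /s; field.
  have lN0 : 0 <= l * N by rewrite (mulr_ge0 l0) ?(ltW N0).
  rewrite -sqrtrM// (_ : l * N * (l / N) = l ^+ 2); last first.
    by field; rewrite !gt_eqF.
  by rewrite sqrtr_sqr ger0_norm.
apply: (@le_trans _ _ (expR (- (48 * l)) * expR (s * `|err t k|))).
  by rewrite -expRD -[leLHS]expR0 ler_expR; lra.
apply: ler_wpM2l; first exact: expR_ge0.
case: (ger0P (err t k)) => _; first by rewrite lerDl expR_ge0.
by rewrite mulrN -mulNr lerDr expR_ge0.
Qed.

End linear_statistics.

(** * Power inequalities *)

Section power_inequalities.
Context (R : realType).
Implicit Types (r g v x y m : R).

Lemma le_powRl g x y : 0 <= g -> 0 <= x -> x <= y -> x `^ g <= y `^ g.
Proof.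
move=> g0 x0 xy; apply: ge0_ler_powR; rewrite ?nnegrE//.
exact: le_trans xy.
Qed.

(** Young's inequality for the product of [v ^ r] and [1], with exponents [1 / r] and
    [1 / (1 - r)]. *)
Lemma bernoulli_powR_le r v : 0 <= r <= 1 -> 0 <= v -> v `^ r <= 1 + r * (v - 1).
Proof.
move=> /andP[r0 r1] v0.
have [->|r_neq0] := eqVneq r 0; first by rewrite powRr0 mul0r addr0.
have [->|r_neq1] := eqVneq r 1; first by rewrite powRr1// mul1r subrKC.
have {}r0 : 0 < r by rewrite lt_neqAle eq_sym r_neq0.
have {}r1 : 0 < 1 - r by rewrite subr_gt0 lt_neqAle r_neq1.
have := @conjugate_powR R (v `^ r) 1 r^-1 (1 - r)^-1 (powR_ge0 _ _) ler01.
rewrite !invr_gt0 !invrK powR1 -powRrM mulfV// powRr1// => /(_ r0 r1); lra.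
Qed.

(** The concave case at exponent [1 / g] and point [u] gives [u ^ (1 / g) <= v]; raise to the power
    [g]. *)
Lemma bernoulli_powR_ge g v : 1 <= g -> 0 <= v -> 1 + g * (v - 1) <= v `^ g.
Proof.
move=> g1 v0; set u := 1 + g * (v - 1).
have g0 : 0 < g by lra.
have [u0|u0] := leP u 0; first exact: le_trans u0 (powR_ge0 _ _).
have u_le : u `^ g^-1 <= v.
  apply: (le_trans (bernoulli_powR_le _ (ltW u0))).
    by rewrite invr_ge0 (ltW g0) invf_le1.
  by rewrite le_eqVlt; apply/orP; left; apply/eqP; rewrite /u; field; rewrite gt_eqF.
rewrite -[leLHS]powRr1 ?(ltW u0)// -[1 in leLHS](mulVf (lt0r_neq0 g0)) powRrM.
by rewrite ge0_ler_powR ?nnegrE ?powR_ge0// ltW.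
Qed.

Lemma powR_scale g x y : 0 < x -> 0 <= y -> y `^ g = x `^ g * (y / x) `^ g.
Proof.
move=> x0 y0; rewrite -powRM ?divr_ge0 ?(ltW x0)//.
by rewrite mulrC divfK// gt_eqF.
Qed.

Lemma powR_tangent g x y : 1 <= g -> 0 < x -> 0 <= y ->
  x `^ g + g * x `^ (g - 1) * (y - x) <= y `^ g.
Proof.
move=> g1 x0 y0; rewrite (powR_scale g x0 y0).
have -> : x `^ g + g * x `^ (g - 1) * (y - x) = x `^ g * (1 + g * (y / x - 1)).
  rewrite -[x `^ g](@mulr_powRB1 _ x g); [|lra|lra].
  by field; rewrite gt_eqF.
by rewrite ler_wpM2l ?powR_ge0// bernoulli_powR_ge// divr_ge0 ?(ltW x0).
Qed.

(** By homogeneity take [x = 1], [y = v]. Bernoulli on [v ^ (g - 1)] gives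
    [v ^ g <= v * (1 + (g - 1) * (v - 1))], which falls short of the target by
    [(2 - g) * (v - 1) ^ 2]. *)
Lemma powR_quadratic g x y : 1 <= g <= 2 -> 0 < x -> 0 <= y ->
  y `^ g <= x `^ g + g * x `^ (g - 1) * (y - x) + x `^ (g - 2) * (y - x) ^+ 2.
Proof.
move=> /andP[g1 g2] x0 y0; rewrite (powR_scale g x0 y0).
have v0 : 0 <= y / x by rewrite divr_ge0 ?(ltW x0).
have xg1 : x * x `^ (g - 1) = x `^ g by apply: mulr_powRB1; lra.
have xg2 : x `^ (g - 2) = x `^ g / x ^+ 2.
  by rewrite powRB ?(lt0r_neq0 x0) ?implybT// (@powR_mulrn _ x 2)// ltW.
have -> : x `^ g + g * x `^ (g - 1) * (y - x) + x `^ (g - 2) * (y - x) ^+ 2 =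
    x `^ g * (1 + g * (y / x - 1) + (y / x - 1) ^+ 2).
  by rewrite xg2 -xg1; field; rewrite gt_eqF.
rewrite ler_wpM2l ?powR_ge0//; move: (y / x) v0 => v v0.
rewrite -(@mulr_powRB1 _ v g); [|lra|lra].
have g01 : 0 <= g - 1 <= 1 by lra.
apply: (@le_trans _ _ (v * (1 + (g - 1) * (v - 1)))).
  by rewrite ler_wpM2l// bernoulli_powR_le.
rewrite -subr_ge0 (_ : _ - _ = (2 - g) * (v - 1) ^+ 2); last by ring.
by rewrite mulr_ge0 ?sqr_ge0// subr_ge0.
Qed.

(** Tangent inequality at the larger of the two points. *)
Lemma dist_powR_le g m x y : 1 <= g -> 0 <= x <= m -> 0 <= y <= m ->
  `|x `^ g - y `^ g| <= g * m `^ (g - 1) * `|x - y|.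
Proof.
move=> g1; wlog yx : x y / y <= x => [hw|] xm ym.
  have [/hw|/ltW/hw] := leP y x; first exact.
  by rewrite distrC [`|y - x|]distrC; apply.
have /andP[x0 xm'] := xm; have /andP[y0 _] := ym.
have [x_eq0|x_neq0] := eqVneq x 0.
  have -> : y = x by apply/le_anti; rewrite yx x_eq0.
  by rewrite !subrr normr0 mulr0.
have xgt0 : 0 < x by rewrite lt_neqAle eq_sym x_neq0.
rewrite !ger0_norm ?subr_ge0//; last first.
  by rewrite ge0_ler_powR ?nnegrE//; lra.
apply: (@le_trans _ _ (g * x `^ (g - 1) * (x - y))).
  by have := powR_tangent g1 xgt0 y0; lra.
rewrite ler_wpM2r ?subr_ge0// ler_wpM2l//; first lra.
by rewrite ge0_ler_powR ?nnegrE//; lra.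
Qed.

(** For [y <= x] the fractions [(x - y) / x] and [y / x] sum to [1], and raising a number of
    [[0, 1]] to the power [g] does not decrease it. *)
Lemma dist_powR_subadditive g x y : 0 < g <= 1 -> 0 <= x -> 0 <= y ->
  `|x `^ g - y `^ g| <= `|x - y| `^ g.
Proof.
move=> /andP[g0 g1]; wlog yx : x y / y <= x => [hw|] x0 y0.
  have [/hw|/ltW/hw] := leP y x; first exact.
  by rewrite distrC [`|y - x|]distrC; apply.
have [x_eq0|x_neq0] := eqVneq x 0.
  have -> : y = x by apply/le_anti; rewrite yx x_eq0.
  by rewrite !subrr normr0 powR_ge0.
have xgt0 : 0 < x by rewrite lt_neqAle eq_sym x_neq0.
have xy0 : 0 <= x - y by rewrite subr_ge0.
rewrite !ger0_norm ?subr_ge0//; last by rewrite ge0_ler_powR ?nnegrE ?(ltW g0).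
rewrite lerBlDr (powR_scale g xgt0 xy0) (powR_scale g xgt0 y0) -mulrDr.
rewrite -[leLHS]mulr1 ler_wpM2l ?powR_ge0//.
have concave v : 0 <= v <= 1 -> v <= v `^ g.
  move=> /andP[]; rewrite le_eqVlt => /predU1P[<- _|v0 v1]; first exact: powR_ge0.
  by apply: ger1_powR => //; rewrite v0.
rewrite (_ : 1 = (x - y) / x + y / x); last by field; rewrite gt_eqF.
by rewrite lerD// concave// divr_ge0 ?(ltW xgt0)//= ler_pdivrMr// mul1r; lra.
Qed.

(** The scale [m] is free: [1 / K] below for sums over the simplex, [1 / N] for squared errors. *)
Lemma powR_le_affine g m y : 0 <= g <= 1 -> 0 < m -> 0 <= y ->
  y `^ g <= m `^ g * (1 + y / m).
Proof.
move=> g01 m0 y0; rewrite (powR_scale g m0 y0) ler_wpM2l ?powR_ge0//.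
have v0 : 0 <= y / m by rewrite divr_ge0 ?(ltW m0).
apply: le_trans (bernoulli_powR_le g01 v0) _; nra.
Qed.

Lemma sum_powR_simplex (K : nat) (p : 'I_K -> R) g : (0 < K)%N ->
  prob_simplex R K p -> 0 <= g <= 1 ->
  \sum_k p k `^ g <= 2 * K%:R `^ (1 - g).
Proof.
move=> K0 [p01 p1] g01; have Kgt0 : 0 < K%:R :> R by rewrite ltr0n.
have iK0 : 0 < K%:R^-1 :> R by rewrite invr_gt0.
apply: (@le_trans _ _ (\sum_k K%:R^-1 `^ g * (1 + p k / K%:R^-1))).
  by apply: ler_sum => k _; apply: powR_le_affine => //; case/andP: (p01 k).
rewrite -mulr_sumr big_split/= -mulr_suml p1 invrK sumr_const card_ord mul1r.
rewrite powRB ?(lt0r_neq0 Kgt0) ?implybT// powRr1 ?(ltW Kgt0)//.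
rewrite -powR_inv1 ?(ltW Kgt0)// -powRrM mulN1r powRN.
by rewrite le_eqVlt; apply/orP; left; apply/eqP; ring.
Qed.

(** The difference of the two sides is a variance. *)
Lemma sqr_wsum_le (K : nat) (p u : 'I_K -> R) : prob_simplex R K p ->
  (\sum_k p k * u k) ^+ 2 <= \sum_k p k * u k ^+ 2.
Proof.
move=> [p01 p1]; set m := \sum_k p k * u k.
rewrite -subr_ge0 (_ : _ - _ = \sum_k p k * (u k - m) ^+ 2).
  by apply: sumr_ge0 => k _; rewrite mulr_ge0 ?sqr_ge0//; case/andP: (p01 k).
transitivity (\sum_k (p k * u k ^+ 2 - 2 * m * (p k * u k) + m ^+ 2 * p k)).
  by rewrite big_split sumrB/= -!mulr_sumr p1 -/m; ring.
by apply: eq_bigr => k _; ring.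
Qed.

Lemma sqr_sum_le (K : nat) (u : 'I_K -> R) :
  (\sum_k u k) ^+ 2 <= K%:R * \sum_k u k ^+ 2.
Proof.
case: K u => [|K] u; first by rewrite big_ord0 expr0n mul0r.
have K0 : 0 < K.+1%:R :> R by rewrite ltr0n.
have : prob_simplex R K.+1 (fun=> K.+1%:R^-1).
  split => [k|]; first by rewrite invr_ge0 ltW//= invf_le1// ler1n.
  by rewrite sumr_const card_ord -[_ *+ _]mulr_natr mulVf ?gt_eqF.
move=> /(sqr_wsum_le u); rewrite -!mulr_sumr exprMn => h.
have := ler_wpM2l (sqr_ge0 K.+1%:R) h.
by rewrite mulrA -exprMn mulfV ?gt_eqF// expr1n mul1r expr2 -mulrA mulVKf ?gt_eqF.
Qed.

End power_inequalities.

(** * Deterministic error of the thresholded estimator *)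

Lemma trunc02_powR_bound (R : realType) (gamma y : R) : 0 <= gamma ->
  0 <= trunc02 y `^ gamma <= 2 `^ gamma.
Proof.
move=> gamma0; rewrite powR_ge0; apply: le_powRl => //.
- by rewrite /trunc02 le_min le_max lexx orbT/=.
- by rewrite /trunc02 ge_min lexx orbT.
Qed.

Section thresholded_term.
Context (R : realType).
Variables (gamma delta p y1 y2 : R).
Hypotheses (gamma1 : 1 < gamma) (delta0 : 0 < delta) (p01 : 0 <= p <= 1).
Hypotheses (y1p : `|y1 - p| <= delta / 2) (y2p : `|y2 - p| <= delta / 2).

Local Notation est := (trunc02 (y2 * (delta <= y1)%R%:R) `^ gamma).
Local Notation C := ((1 + gamma) * 4 `^ gamma).

Let p0 : 0 <= p. Proof. by case/andP: p01. Qed.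

(* [lra] does not look at the hypotheses of a section. *)
Local Ltac section_facts := have := gamma1; have := delta0; have := p0.
Local Ltac slra := section_facts; lra.
Local Ltac snra := section_facts; nra.

Let pow2p : (2 * p) `^ gamma = 2 `^ gamma * (p * p `^ (gamma - 1)).
Proof. by rewrite powRM// mulr_powRB1//; slra. Qed.

Let pow2_ge1 : 1 <= 2 `^ gamma.
Proof. by rewrite -[leLHS](powRr0 2) ler_powR//; slra. Qed.

Let pow4 : 4 `^ gamma = 2 `^ gamma * 2 `^ gamma :> R.
Proof. by rewrite -powRM// -natrM. Qed.

Let pow2B1 : 2 `^ (gamma - 1) <= 2 `^ gamma :> R.
Proof. by apply: ler_powR; slra. Qed.

Let small_term : p < 3 / 2 * delta -> `|est - p `^ gamma| <= (2 * p) `^ gamma.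
Proof.
move=> p_small.
(* If the coordinate is kept, [y1 >= delta] forces [p >= delta / 2], hence
   [y2 <= p + delta / 2 <= 2 * p]; otherwise the estimate is [0]. *)
have est_le : 0 <= est <= (2 * p) `^ gamma.
  rewrite powR_ge0/=; have [y1_ge|y1_lt] := leP delta y1; last first.
    rewrite mulr0 /trunc02 maxxx min_l// powR0 ?powR_ge0//; slra.
  rewrite mulr1; apply: le_powRl; first slra.
    by rewrite /trunc02 le_min le_max lexx orbT/=.
  rewrite /trunc02 ge_min ge_max; apply/orP; left; apply/andP; split; last slra.
  by move: y1p y2p; rewrite !ler_norml; slra.
have : 0 <= p `^ gamma <= (2 * p) `^ gamma.
  by rewrite powR_ge0; apply: le_powRl; slra.
by move: est_le; rewrite ler_norml; slra.
Qed.

Let large_term : 3 / 2 * delta <= p -> est = y2 `^ gamma /\ 0 <= y2 <= 2 * p.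
Proof.
move=> p_large; move: y1p y2p; rewrite !ler_norml => h1 h2.
have -> : (delta <= y1) by slra.
split; last slra.
by rewrite mulr1 /trunc02 max_l ?min_l//; case/andP: p01; slra.
Qed.

Let large_diff : 3 / 2 * delta <= p ->
  `|est - p `^ gamma| <= gamma * 2 `^ (gamma - 1) * p `^ (gamma - 1) * `|y2 - p|.
Proof.
move=> /large_term[-> y2_2p].
have -> : gamma * 2 `^ (gamma - 1) * p `^ (gamma - 1) = gamma * (2 * p) `^ (gamma - 1).
  by rewrite powRM// mulrA.
by apply: dist_powR_le => //; slra.
Qed.

Let powR_delta (r : R) : p < 3 / 2 * delta -> 0 <= r ->
  p `^ r <= 2 `^ r * delta `^ r.
Proof.
move=> p_small r0; rewrite -powRM//; last exact: ltW.
by apply: le_powRl; slra.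
Qed.

(** The bound is linear in [p], so its sum over the simplex does not involve [K]. For large [p], one
    factor [p] is extracted and the rest, [p ^ (gamma - 2)], is decreasing in [p]. *)
Lemma thresholded_term_lt2 : gamma < 2 ->
  `|est - p `^ gamma| <= C * delta `^ (gamma - 1) * p.
Proof.
move=> gamma2; have d1 := powR_ge0 delta (gamma - 1).
have [p_large|p_small] := leP (3 / 2 * delta) p.
  apply: (le_trans (large_diff p_large)).
  have pgt0 : 0 < p by slra.
  have -> : p `^ (gamma - 1) = p * p `^ (gamma - 2).
    rewrite -[X in X * _](powRr1 p0) -powRD; last by rewrite (lt0r_neq0 pgt0) implybT.
    by congr (_ `^ _); ring.
  have -> : delta `^ (gamma - 1) = delta * delta `^ (gamma - 2).
    rewrite -[X in X * _](powRr1 (ltW delta0)) -powRD; last by rewrite (lt0r_neq0 delta0) implybT.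
    by congr (_ `^ _); ring.
  have pd : p `^ (gamma - 2) <= delta `^ (gamma - 2).
    rewrite -(opprB 2 gamma) !powRN lef_pV2 ?posrE ?powR_gt0//.
    by apply: le_powRl; slra.
  apply: (@le_trans _ _ (gamma * 2 `^ gamma * (p * delta `^ (gamma - 2)) * delta)).
    apply: ler_pM => //.
    - by rewrite !mulr_ge0 ?powR_ge0//; slra.
    - apply: ler_pM; rewrite ?mulr_ge0 ?powR_ge0//; [slra| |exact: ler_wpM2l].
      by rewrite ler_wpM2l//; slra.
    - by apply: le_trans y2p _; slra.
  rewrite (_ : _ * delta = gamma * 2 `^ gamma * (delta * delta `^ (gamma - 2) * p)); last by ring.
  rewrite -[leRHS]mulrA; apply: ler_wpM2r.
    by rewrite !mulr_ge0 ?powR_ge0// ltW.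
  by rewrite pow4; have := pow2_ge1; snra.
apply: (le_trans (small_term p_small)); rewrite pow2p.
have := powR_delta p_small (_ : 0 <= gamma - 1); rewrite subr_ge0 => /(_ (ltW gamma1)) h.
apply: (@le_trans _ _ (2 `^ gamma * (p * (2 `^ gamma * delta `^ (gamma - 1))))).
  rewrite ler_wpM2l ?powR_ge0// ler_wpM2l//; apply: (le_trans h).
  by rewrite ler_wpM2r.
rewrite (_ : _ * _ = 4 `^ gamma * (delta `^ (gamma - 1) * p)); last by rewrite pow4; ring.
rewrite -[leRHS]mulrA; apply: ler_wpM2r; first by rewrite mulr_ge0 ?powR_ge0.
by rewrite -[leLHS]mul1r ler_wpM2r ?powR_ge0//; slra.
Qed.

Let delta_powR : delta * delta `^ (gamma - 1) = delta `^ gamma.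
Proof. by rewrite mulr_powRB1//; slra. Qed.

Let small_termK : p < 3 / 2 * delta ->
  `|est - p `^ gamma| <= 4 `^ gamma * delta `^ gamma.
Proof.
move=> p_small; apply: (le_trans (small_term p_small)).
rewrite -powRM//; last exact: ltW.
by apply: le_powRl; slra.
Qed.

(** The first-order term is subtracted with its sign, to be averaged over all coordinates at once.
    For large [p] the quadratic remainder is at most [delta ^ gamma]; for small [p] so is, up to a
    constant, the first-order term itself. *)
Lemma thresholded_term_taylor : gamma < 2 ->
  `|est - p `^ gamma - gamma * (p `^ (gamma - 1) * (y2 - p))| <= C * delta `^ gamma.
Proof.
move=> gamma2; have d1 := powR_ge0 delta gamma.
have [p_large|p_small] := leP (3 / 2 * delta) p.
  have [-> /andP[y20 y22]] := large_term p_large.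
  have pgt0 : 0 < p by slra.
  have lo : p `^ gamma + gamma * p `^ (gamma - 1) * (y2 - p) <= y2 `^ gamma.
    by apply: powR_tangent => //; exact: ltW.
  have hi := @powR_quadratic R gamma p y2 (_ : 1 <= gamma <= 2) pgt0 y20.
  have {}hi : y2 `^ gamma <= p `^ gamma + gamma * p `^ (gamma - 1) * (y2 - p) +
      p `^ (gamma - 2) * (y2 - p) ^+ 2 by apply: hi; rewrite !ltW.
  rewrite ger0_norm; last slra.
  apply: (@le_trans _ _ (p `^ (gamma - 2) * (y2 - p) ^+ 2)); first slra.
  apply: (@le_trans _ _ (delta `^ (gamma - 2) * delta ^+ 2)).
    apply: ler_pM; rewrite ?powR_ge0 ?sqr_ge0//.
      rewrite -(opprB 2 gamma) !powRN lef_pV2 ?posrE ?powR_gt0//.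
      by apply: le_powRl; slra.
    by move: y2p; rewrite ler_norml; snra.
  rewrite -(@powR_mulrn _ delta 2)// ?(ltW delta0)// -powRD; last by rewrite (lt0r_neq0 delta0) implybT.
  rewrite subrK -[leLHS]mul1r ler_wpM2r//.
  by rewrite pow4; have := pow2_ge1; snra.
apply: (le_trans (ler_normB _ _)).
have Y : `|gamma * (p `^ (gamma - 1) * (y2 - p))| <= gamma * 4 `^ gamma * delta `^ gamma.
  rewrite !normrM ger0_norm ?(ltW (lt_trans _ gamma1))// -mulrA ler_wpM2l ?(ltW (lt_trans _ gamma1))//.
  rewrite ger0_norm ?powR_ge0//.
  apply: (@le_trans _ _ ((2 `^ gamma * delta `^ (gamma - 1)) * delta)).
    apply: ler_pM => //; rewrite ?powR_ge0//.
      apply: (le_trans (powR_delta p_small _)); first slra.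
      by rewrite ler_wpM2r ?powR_ge0.
    by apply: le_trans y2p _; slra.
  rewrite -mulrA [delta `^ _ * _]mulrC delta_powR ler_wpM2r// pow4.
  by rewrite -[leLHS]mul1r ler_wpM2r ?powR_ge0.
by have := small_termK p_small; slra.
Qed.

(** The two bounds differ only in the treatment of small [p], linear in [p] or uniform. For large
    [p], [p ^ (gamma - 1) <= p] since [gamma - 1 >= 1] and [p <= 1]. *)
Lemma thresholded_term_ge2 : 2 <= gamma ->
  `|est - p `^ gamma| <= C * (delta `^ (gamma - 1) * p) + C * (p * `|y2 - p|) /\
  `|est - p `^ gamma| <= C * delta `^ gamma + C * (p * `|y2 - p|).
Proof.
move=> gamma2.
have C0 : 0 <= C by rewrite mulr_ge0 ?powR_ge0//; slra.
have C4 : 4 `^ gamma <= C by rewrite -[leLHS]mul1r ler_wpM2r ?powR_ge0//; slra.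
have A0 : 0 <= C * (delta `^ (gamma - 1) * p).
  by apply: mulr_ge0 => //; rewrite mulr_ge0 ?powR_ge0.
have B0 : 0 <= C * delta `^ gamma by apply: mulr_ge0; rewrite ?powR_ge0.
have D0 : 0 <= C * (p * `|y2 - p|) by apply: mulr_ge0 => //; rewrite mulr_ge0.
have [p_large|p_small] := leP (3 / 2 * delta) p.
  suff : `|est - p `^ gamma| <= C * (p * `|y2 - p|) by move=> h; split; slra.
  apply: (le_trans (large_diff p_large)).
  rewrite -mulrA; apply: ler_pM.
  - by rewrite mulr_ge0 ?powR_ge0//; slra.
  - by rewrite mulr_ge0 ?powR_ge0.
  - by apply: ler_pM; rewrite ?powR_ge0//; [slra|slra|rewrite pow4; have := pow2_ge1; have := pow2B1; nra].
  rewrite ler_wpM2r// ge1r_powR//; last slra.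
  by apply/andP; split; [slra|case/andP: p01].
split; last first.
  apply: (le_trans (small_termK p_small)).
  have : 4 `^ gamma * delta `^ gamma <= C * delta `^ gamma by rewrite ler_wpM2r ?powR_ge0.
  slra.
apply: (@le_trans _ _ (C * (delta `^ (gamma - 1) * p))); last slra.
apply: (le_trans (small_term p_small)); rewrite pow2p.
have h := powR_delta p_small (_ : 0 <= gamma - 1).
apply: (@le_trans _ _ (2 `^ gamma * (p * (2 `^ gamma * delta `^ (gamma - 1))))).
  rewrite ler_wpM2l ?powR_ge0// ler_wpM2l//; apply: (le_trans (h _)); first slra.
  by rewrite ler_wpM2r ?powR_ge0.
rewrite (_ : _ * _ = 4 `^ gamma * (delta `^ (gamma - 1) * p)); last by rewrite pow4; ring.
by rewrite ler_wpM2r// mulr_ge0 ?powR_ge0.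
Qed.

End thresholded_term.

(** * Summation over the coordinates, on the event of small errors *)

Section thresholded_sum.
Context (R : realType) (K : nat).
Variables (gamma delta : R) (p y1 y2 : 'I_K -> R).
Hypotheses (gamma1 : 1 < gamma) (delta0 : 0 < delta).
Hypothesis p_simplex : prob_simplex R K p.
Hypothesis y1p : forall k, `|y1 k - p k| <= delta / 2.
Hypothesis y2p : forall k, `|y2 k - p k| <= delta / 2.

Local Notation est k := (trunc02 (y2 k * (delta <= y1 k)%R%:R) `^ gamma).
Local Notation C := ((1 + gamma) * 4 `^ gamma).
Local Notation D := (\sum_k est k - power_sum gamma p).

Let DE : D = \sum_k (est k - p k `^ gamma).
Proof. by rewrite sumrB. Qed.

Let sum_dist (b : 'I_K -> R) : (forall k, `|est k - p k `^ gamma| <= b k) ->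
  `|D| <= \sum_k b k.
Proof.
by move=> h; rewrite DE; apply: (le_trans (ler_norm_sum _ _ _)); exact: ler_sum.
Qed.

Let p01 k : 0 <= p k <= 1. Proof. by case: p_simplex. Qed.
Let p1 : \sum_k p k = 1. Proof. by case: p_simplex. Qed.

Let C0 : 0 <= C.
Proof. by rewrite mulr_ge0 ?powR_ge0//; have := gamma1; lra. Qed.

Let sqr_powR (r : R) : (delta `^ r) ^+ 2 = (delta ^+ 2) `^ r.
Proof. by rewrite !expr2 powRM// ltW. Qed.

Let sqr_le_sum (u v b : R) : `|u| <= v + b -> 0 <= v -> 0 <= b ->
  u ^+ 2 <= 2 * v ^+ 2 + 2 * b ^+ 2.
Proof.
move=> h v0 b0; apply: (@le_trans _ _ ((v + b) ^+ 2)).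
  by rewrite -(real_normK (num_real u)) ler_sqr ?nnegrE// addr_ge0.
rewrite -subr_ge0 (_ : _ - _ = (v - b) ^+ 2) ?sqr_ge0//; ring.
Qed.

Let wsum_le : (\sum_k p k * `|y2 k - p k|) ^+ 2 <= \sum_k p k * (y2 k - p k) ^+ 2.
Proof.
apply: (le_trans (sqr_wsum_le _ p_simplex)); apply: ler_sum => k _.
by rewrite real_normK ?num_real.
Qed.

Let wsum_ge0 : 0 <= \sum_k p k * `|y2 k - p k|.
Proof. by apply: sumr_ge0 => k _; rewrite mulr_ge0//; case/andP: (p01 k). Qed.

Lemma thresholded_sum_sparse :
  D ^+ 2 <= 2 * C ^+ 2 * (delta ^+ 2) `^ (gamma - 1) +
            2 * C ^+ 2 * \sum_k p k * (y2 k - p k) ^+ 2.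
Proof.
set W := \sum_k p k * `|y2 k - p k|.
suff h : `|D| <= C * delta `^ (gamma - 1) + C * W.
  have := sqr_le_sum h (mulr_ge0 C0 (powR_ge0 _ _)) (mulr_ge0 C0 wsum_ge0).
  have := ler_wpM2l (sqr_ge0 C) wsum_le; rewrite -/W !(exprMn _ C) sqr_powR.
  by move: (C ^+ 2) => C2; lra.
rewrite -[X in C * X + _]mulr1 -[X in _ * (_ * X) + _]p1 !mulr_sumr -big_split/=.
apply: sum_dist => k.
have [gamma2|gamma2] := leP 2 gamma.
  by have [] := thresholded_term_ge2 gamma1 delta0 (p01 k) (y1p k) (y2p k) gamma2.
(* For [gamma < 2] the first term already absorbs the error; the nonnegative second one is added to
   give both cases a common form. *)
have h := thresholded_term_lt2 gamma1 delta0 (p01 k) (y1p k) (y2p k) gamma2.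
rewrite mulrA; apply: (le_trans h); rewrite lerDl mulr_ge0// mulr_ge0//.
by case/andP: (p01 k).
Qed.

Let K_delta : 0 <= C * (K%:R * delta `^ gamma).
Proof. by rewrite mulr_ge0// mulr_ge0 ?powR_ge0. Qed.

Let sqr_K_delta : (C * (K%:R * delta `^ gamma)) ^+ 2 =
  C ^+ 2 * K%:R ^+ 2 * (delta ^+ 2) `^ gamma.
Proof. by rewrite !exprMn sqr_powR mulrA. Qed.

Let sum_cst (c : R) : K%:R * c = \sum_(k < K) c.
Proof. by rewrite sumr_const card_ord mulr_natl. Qed.

Lemma thresholded_sum_dense_ge2 : 2 <= gamma ->
  D ^+ 2 <= 2 * C ^+ 2 * K%:R ^+ 2 * (delta ^+ 2) `^ gamma +
            2 * C ^+ 2 * \sum_k p k * (y2 k - p k) ^+ 2.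
Proof.
move=> gamma2; set W := \sum_k p k * `|y2 k - p k|.
have h : `|D| <= C * (K%:R * delta `^ gamma) + C * W.
  rewrite sum_cst !mulr_sumr -big_split/=; apply: sum_dist => k.
  by have [] := thresholded_term_ge2 gamma1 delta0 (p01 k) (y1p k) (y2p k) gamma2.
have := sqr_le_sum h K_delta (mulr_ge0 C0 wsum_ge0).
have := ler_wpM2l (sqr_ge0 C) wsum_le; rewrite -/W sqr_K_delta (exprMn _ C W).
by move: (C ^+ 2) => C2; lra.
Qed.

(** The linear part stays a signed sum under the square, so that [linear_sqr] bounds its second
    moment without a factor [K]. *)
Lemma thresholded_sum_dense_lt2 : gamma < 2 ->
  D ^+ 2 <= 2 * C ^+ 2 * K%:R ^+ 2 * (delta ^+ 2) `^ gamma +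
            2 * C ^+ 2 * (\sum_k p k `^ (gamma - 1) * (y2 k - p k)) ^+ 2.
Proof.
move=> gamma2; set V := \sum_k p k `^ (gamma - 1) * (y2 k - p k).
have gamma0 : 0 <= gamma by have := gamma1; lra.
have h : `|D| <= C * (K%:R * delta `^ gamma) + gamma * `|V|.
  rewrite -[D](subrK (gamma * V)); apply: (le_trans (ler_normD _ _)).
  rewrite normrM (ger0_norm gamma0) lerD2r sum_cst mulr_sumr.
  rewrite DE /V mulr_sumr -sumrB; apply: (le_trans (ler_norm_sum _ _ _)).
  apply: ler_sum => k _.
  exact: (thresholded_term_taylor gamma1 delta0 (p01 k) (y1p k) (y2p k) gamma2).
have := sqr_le_sum h K_delta (mulr_ge0 gamma0 (normr_ge0 V)).
rewrite sqr_K_delta (exprMn _ gamma) real_normK ?num_real//.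
suff : gamma ^+ 2 * V ^+ 2 <= C ^+ 2 * V ^+ 2 by move: (C ^+ 2) => C2; lra.
apply: ler_wpM2r; first exact: sqr_ge0.
rewrite ler_sqr ?nnegrE// -[leLHS]mulr1; apply: ler_pM => //.
  by have := gamma1; lra.
by rewrite -[leLHS](powRr0 4) ler_powR//; lra.
Qed.

Lemma thresholded_sum_crude (z1 z2 : 'I_K -> R) :
  (\sum_k trunc02 (z2 k * (delta <= z1 k)%R%:R) `^ gamma - power_sum gamma p) ^+ 2
  <= (2 `^ gamma * K%:R) ^+ 2.
Proof.
have gamma0 : 0 <= gamma by have := gamma1; lra.
rewrite -real_normK ?num_real// ler_sqr ?nnegrE ?mulr_ge0 ?powR_ge0//.
rewrite [leRHS]mulrC sum_cst /power_sum -sumrB.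
apply: (le_trans (ler_norm_sum _ _ _)); apply: ler_sum => k _.
have := trunc02_powR_bound (z2 k * (delta <= z1 k)%R%:R) gamma0.
have : 0 <= p k `^ gamma <= 2 `^ gamma.
  by rewrite powR_ge0; apply: le_powRl => //; case/andP: (p01 k) => *; lra.
by move=> /andP[a1 a2] /andP[b1 b2]; rewrite ler_norml; lra.
Qed.

End thresholded_sum.

(** * Risk bounds *)

Section nonlinear_regime.
Context d (T : measurableType d) (R : realType) (K n : nat).
Variables (P : probability T R) (p : 'I_K -> R) (alpha c gamma : R).
Variables (x : 'I_n -> T -> 'I_K) (w : 'I_n -> 'I_K -> T -> R).

Local Notation N := (alpha ^+ 2 * n%:R).

Lemma quadratic_risk_lt1 : laplace_sample P p x w -> prob_simplex R K p ->
  0 < alpha < 1 -> (0 < n)%N -> (0 < K)%N -> 1 <= N -> 1 <= c -> 0 < gamma < 1 ->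
  (quadratic_risk P (privatize alpha x w) (Fbar_lt1 c alpha gamma)
     (power_sum gamma p) <=
   ((4 * c `^ (2 * gamma) + 64 * expR 1) *
    Num.min (K%:R `^ (2 * (1 - gamma))) (K%:R ^+ 2 / N `^ gamma))%:E)%E.
Proof.
move=> sample p_simplex alpha01 n0 K0 N1 c1 /andP[gamma0 gamma1].
have [p01 p1] := p_simplex.
have Kgt0 : 0 < K%:R :> R by rewrite ltr0n.
have N0 : 0 < N by lra.
have c0 : 0 < c by lra.
have e0 : 0 < expR 1 :> R by exact: expR_gt0.
(* Shows that the two rates differ by the factor [(K ^ 2 / N) ^ gamma], so comparing [K ^ 2] with
   [N] decides the minimum. *)
have K2 : K%:R ^+ 2 = K%:R `^ (2 * (1 - gamma)) * (K%:R ^+ 2) `^ gamma.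
  rewrite -(@powR_mulrn _ K%:R 2)// -powRrM -powRD; last by rewrite (lt0r_neq0 Kgt0) implybT.
  by congr (_ `^ _); ring.
have Ng0 : 0 < N `^ gamma by exact: powR_gt0.
have Kg0 : 0 < K%:R `^ (2 * (1 - gamma)) :> R by exact: powR_gt0.
have c2g : 1 <= c `^ (2 * gamma) by rewrite -[leLHS](powRr0 c) ler_powR//; lra.
have c2gE : c `^ (2 * gamma) = (c ^+ 2) `^ gamma by rewrite powRrM (@powR_mulrn _ c 2)// ltW.
rewrite /quadratic_risk unlock.
have KtauE : (K%:R <= (tau c alpha n)^-1) = (c * K%:R <= Num.sqrt N).
  by rewrite /tau invf_div ler_pdivlMr// mulrC.
have [K_le|K_gt] := leP (c * K%:R) (Num.sqrt N).
  have KN : K%:R ^+ 2 <= N.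
    rewrite -[leRHS](sqr_sqrtr (ltW N0)) ler_sqr ?nnegrE// ?sqrtr_ge0//.
    by apply: le_trans K_le; rewrite -[leLHS]mul1r ler_wpM2r// ltW.
  have minE : Num.min (K%:R `^ (2 * (1 - gamma))) (K%:R ^+ 2 / N `^ gamma) =
      K%:R ^+ 2 / N `^ gamma.
    apply/min_idPr; rewrite ler_pdivrMr// K2 ler_wpM2l ?powR_ge0//.
    by apply: le_powRl => //; rewrite ?sqr_ge0// ltW.
  rewrite minE.
  (* Majorant of the loss: Cauchy-Schwarz gives the factor [K], and [powR_le_affine] at scale
     [1 / N] bounds [(Y k ^ 2) ^ gamma] by an affine function of [Y k ^ 2]. *)
  pose g t := K%:R * \sum_k (N^-1 `^ gamma +
    N^-1 `^ gamma * N * (zhat (privatize alpha x w t) k - p k) ^+ 2).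
  have mean_g : mean_le P g (K%:R * \sum_(k < K) (N^-1 `^ gamma +
      N^-1 `^ gamma * N * (64 * expR 1 / N))).
    apply: mean_leZ => //; apply: mean_le_sum => k.
    apply: mean_leD; first exact/mean_le_cst/powR_ge0.
    apply: mean_leZ; first by rewrite mulr_ge0 ?powR_ge0// ltW.
    exact: err_sqr.
  apply: (@le_trans _ _ (K%:R * \sum_(k < K) (N^-1 `^ gamma +
      N^-1 `^ gamma * N * (64 * expR 1 / N)))%:E); last first.
    rewrite lee_fin sumr_const card_ord -[X in _ * X]mulr_natr.
    have -> : N^-1 `^ gamma = (N `^ gamma)^-1.
      by rewrite -powR_inv1 ?(ltW N0)// -powRrM mulN1r powRN.
    rewrite (_ : _ * _ = (1 + 64 * expR 1) * (K%:R ^+ 2 / N `^ gamma)); last first.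
      field; rewrite !gt_eqF//; first by case/andP: alpha01.
      by rewrite ltr0n.
    apply: ler_wpM2r; last lra.
    by rewrite divr_ge0 ?sqr_ge0// ltW.
  apply: (integral_le_mean _ _ mean_g) => t; first exact: sqr_ge0.
  rewrite /Fbar_lt1 KtauE K_le mul1r /Fhat /power_sum -sumrB.
  apply: (le_trans (sqr_sum_le _)); apply: ler_wpM2l => //.
  apply: ler_sum => k _; set z := zhat _ k.
  have pk := p01 k.
  have T0 : 0 <= trunc02 z by rewrite /trunc02 le_min le_max lexx orbT/=.
  (* Projecting onto [[0, 2]], which contains [p k], moves [z] no further from it. *)
  have dist_trunc : `|trunc02 z - p k| <= `|z - p k|.
    have /andP[pk0 pk1] := pk; rewrite /trunc02.
    have [z0|z0] := leP z 0.
      by rewrite min_l// sub0r normrN ger0_norm// ler0_norm; move: z0; lra.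
    have [z2//|z2] := leP z 2.
    by rewrite !ger0_norm; lra.
  rewrite -[leLHS]real_normK ?num_real//.
  apply: (@le_trans _ _ ((`|z - p k| `^ gamma) ^+ 2)).
    rewrite ler_sqr ?nnegrE ?powR_ge0//.
    apply: (@le_trans _ _ (`|trunc02 z - p k| `^ gamma)).
      by apply: dist_powR_subadditive => //; case/andP: pk => *; lra.
    by apply: le_powRl => //; exact: ltW.
  rewrite (_ : _ ^+ 2 = ((z - p k) ^+ 2) `^ gamma); last first.
    by rewrite expr2 -powRM// -expr2 real_normK ?num_real.
  have := @powR_le_affine R gamma N^-1 ((z - p k) ^+ 2).
  rewrite invrK invr_gt0 sqr_ge0 => /(_ _ N0 isT) h.
  by apply: (le_trans (h _)); lra.
have Ebar t : Fbar_lt1 c alpha gamma (privatize alpha x w t) = 0.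
  by rewrite /Fbar_lt1 KtauE leNgt K_gt mul0r.
have F0 : 0 <= power_sum gamma p by apply: sumr_ge0 => k _; exact: powR_ge0.
have F_le : power_sum gamma p ^+ 2 <= 4 * K%:R `^ (2 * (1 - gamma)).
  have -> : 4 * K%:R `^ (2 * (1 - gamma)) = (2 * K%:R `^ (1 - gamma)) ^+ 2 :> R.
    rewrite exprMn -(@powR_mulrn _ (K%:R `^ (1 - gamma)) 2) ?powR_ge0// -powRrM.
    by rewrite [_ * 2]mulrC; congr (_ * _); ring.
  rewrite ler_sqr ?nnegrE ?mulr_ge0 ?powR_ge0//.
  by apply: sum_powR_simplex => //; lra.
have NK : N `^ gamma <= c `^ (2 * gamma) * (K%:R ^+ 2) `^ gamma.
  rewrite c2gE -powRM ?sqr_ge0// -exprMn; apply: le_powRl; [exact: ltW|exact: ltW|].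
  rewrite -[leLHS](sqr_sqrtr (ltW N0)) ler_sqr ?nnegrE ?sqrtr_ge0//; first exact: ltW.
  by rewrite mulr_ge0// ltW.
(* When the estimator is cut to [0], [N < c ^ 2 * K ^ 2], so the first rate exceeds the second by at
   most the factor [c ^ (2 * gamma)]. *)
have Kmin : K%:R `^ (2 * (1 - gamma)) <= c `^ (2 * gamma) *
    Num.min (K%:R `^ (2 * (1 - gamma))) (K%:R ^+ 2 / N `^ gamma).
  rewrite /Num.min; case: ifP => _.
    by rewrite -[leLHS]mul1r ler_wpM2r// ltW.
  rewrite mulrA ler_pdivlMr// K2 mulrCA ler_wpM2l// ltW.
apply: (@le_trans _ _ (power_sum gamma p ^+ 2)%:E).
  apply: (integral_le_mean (g := fun=> power_sum gamma p ^+ 2)) => [t|t|].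
  - exact: sqr_ge0.
  - by rewrite Ebar sub0r sqrrN.
  - by apply: mean_le_cst; exact: sqr_ge0.
rewrite lee_fin; apply: (le_trans F_le).
have m0 : 0 <= Num.min (K%:R `^ (2 * (1 - gamma))) (K%:R ^+ 2 / N `^ gamma).
  by rewrite le_min (ltW Kg0) divr_ge0 ?sqr_ge0// ltW.
apply: (@le_trans _ _ (4 * c `^ (2 * gamma) *
    Num.min (K%:R `^ (2 * (1 - gamma))) (K%:R ^+ 2 / N `^ gamma))).
  by rewrite -mulrA ler_wpM2l.
by apply: ler_wpM2r => //; lra.
Qed.

End nonlinear_regime.

(** * Risk for [gamma > 1] *)

Section linear_regime.
Context d (T : measurableType d) (R : realType) (K n : nat).
Variables (P : probability T R) (p : 'I_K -> R) (alpha gamma : R).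
Variables (x : 'I_2 * 'I_n -> T -> 'I_K) (w : 'I_2 * 'I_n -> 'I_K -> T -> R).

Local Notation N := (alpha ^+ 2 * n%:R).
Local Notation L := (ln (K * n)%:R : R).
Local Notation delta := (tauhat alpha K n).
Local Notation sub s := (fun i : 'I_n => (s, i)).
Local Notation err s t k :=
  (zhat (privatize alpha (x \o sub s) (w \o sub s) t) k - p k).
Local Notation C := ((1 + gamma) * 4 `^ gamma).

Hypothesis sample : laplace_sample P p x w.
Hypothesis p_simplex : prob_simplex R K p.
Hypothesis alpha01 : 0 < alpha < 1.
Hypotheses (n0 : (0 < n)%N) (K0 : (0 < K)%N) (N1 : 1 <= N).
Hypothesis ln_small : 2 * ln K%:R <= n%:R :> R.
Hypothesis gamma1 : 1 < gamma.

Let alpha0 : 0 < alpha. Proof. by case/andP: alpha01. Qed.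
Let N0 : 0 < N. Proof. exact: lt_le_trans N1. Qed.

Let N_le_n : N <= n%:R.
Proof.
rewrite -[leRHS]mul1r ler_wpM2r// expr_le1//; first by case/andP: alpha01 => _ /ltW.
exact: ltW.
Qed.

(** As [alpha < 1], the condition [N >= 1] excludes [n = 1]; hence [L] and the threshold are
    positive. *)
Let Kn_gt1 : 1 < (K * n)%:R :> R.
Proof.
have n1 : 1 < n%:R :> R.
  apply: (le_lt_trans N1); rewrite -[ltRHS]mul1r ltr_pM2r ?ltr0n//.
  by rewrite expr_lt1//; [case/andP: alpha01|exact: ltW].
apply: (lt_le_trans n1); rewrite natrM -[leLHS]mul1r.
by apply: ler_wpM2r => //; rewrite ler1n.
Qed.

Let L0 : 0 < L. Proof. exact: ln_gt0. Qed.

(** Makes [L] an admissible level for [mean_tail_bound]. Half of [n] covers [ln K]; the other half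
    covers [ln n], as [exp (n / 2) >= (1 + n / 4) ^ 2 >= n]. *)
Let L_le_n : L <= n%:R.
Proof.
have n_pos : 0 < n%:R :> R by rewrite ltr0n.
have K_pos : 0 < K%:R :> R by rewrite ltr0n.
have ln_n : ln n%:R <= n%:R / 2 :> R.
  rewrite -[leRHS]expRK ler_ln ?posrE ?expR_gt0//.
  rewrite (_ : n%:R / 2 = n%:R / 4 + n%:R / 4); last by field.
  rewrite expRD; have := expR_ge1Dx (n%:R / 4 : R) => h.
  apply: (@le_trans _ _ ((1 + n%:R / 4) * (1 + n%:R / 4))).
    rewrite -subr_ge0 (_ : _ - _ = (n%:R / 4 - 1) ^+ 2); first exact: sqr_ge0.
    by field.
  by apply: ler_pM => //; rewrite addr_ge0// divr_ge0.
by rewrite natrM lnM ?posrE//; have := ln_small; lra.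
Qed.

Let L_ge0 : 0 <= L <= n%:R. Proof. by rewrite (ltW L0) L_le_n. Qed.

Let delta0 : 0 < delta.
Proof.
apply: mulr_gt0; last by rewrite sqrtr_gt0 divr_gt0.
by rewrite /sigma_noise; lra.
Qed.

Let delta_half : delta / 2 = 192 * Num.sqrt (L / N).
Proof. by rewrite /tauhat /sigma_noise; field. Qed.

(** The constant is the same for [r = gamma - 1] and [r = gamma], as needed for a common constant in
    both rates. *)
Let delta_sqr r : 0 <= r <= gamma ->
  (delta ^+ 2) `^ r <= 384 `^ (2 * gamma) * (L `^ r / N `^ r).
Proof.
move=> /andP[r0 rg]; rewrite /tauhat /sigma_noise exprMn.
have LN0 : 0 <= L / N by rewrite divr_ge0 ?(ltW L0) ?(ltW N0).
rewrite sqr_sqrtr// (@powRM _ _ (L / N)) ?sqr_ge0//.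
rewrite (@powRM _ L) ?invr_ge0 ?(ltW L0) ?(ltW N0)//.
have -> : N^-1 `^ r = (N `^ r)^-1.
  by rewrite -powR_inv1 ?(ltW N0)// -powRrM mulN1r powRN.
apply: ler_wpM2r; first by rewrite divr_ge0 ?powR_ge0.
have -> : 192 * 2 = 384 :> R by ring.
rewrite -(@powR_mulrn _ 384 2) ?ler0n// -powRrM.
by apply: ler_powR; lra.
Qed.

Let sub_sample s : laplace_sample P p (x \o sub s) (w \o sub s).
Proof. by apply: (laplace_sample_inj sample) => i j []. Qed.

Let tails t := \sum_k
  (tail_bound p alpha (x \o sub ord0) (w \o sub ord0) L k t +
   tail_bound p alpha (x \o sub ord_max) (w \o sub ord_max) L k t).

Let tails_ge0 t : 0 <= tails t.
Proof. by apply: sumr_ge0 => k _; rewrite addr_ge0// tail_bound_ge0. Qed.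

Let mean_tails :
  mean_le P (fun t => (2 `^ gamma * K%:R) ^+ 2 * tails t)
    (4 * (2 `^ gamma) ^+ 2 / N).
Proof.
have n_pos : 0 < n%:R :> R by rewrite ltr0n.
have K_pos : 0 < K%:R :> R by rewrite ltr0n.
have m k := mean_leD
  (mean_tail_bound (sub_sample ord0) p_simplex alpha01 n0 k L_ge0)
  (mean_tail_bound (sub_sample ord_max) p_simplex alpha01 n0 k L_ge0).
have M0 := sqr_ge0 (2 `^ gamma * K%:R).
have [h1 h2 h3] := mean_leZ M0 (mean_le_sum (index_enum 'I_K) m).
split => //; apply: (le_trans h3); rewrite lee_fin.
(* The factor [K ^ 3] cancels the [K ^ 2] of the crude loss and the sum over [K] coordinates; the
   remaining [1 / n] is at most [1 / N]. *)
have expL : expR (- (47 * L)) <= (n%:R * K%:R ^+ 3)^-1.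
  apply: (@le_trans _ _ (expR (- (3 * L)))).
    by rewrite ler_expR; have := L0; lra.
  rewrite expRN lef_pV2 ?posrE ?expR_gt0 ?mulr_gt0 ?exprn_gt0//.
  rewrite expRM_natl lnK ?posrE ?(lt_trans _ Kn_gt1)// natrM exprMn mulrC.
  apply: ler_wpM2l; first by rewrite exprn_ge0// ltW.
  by rewrite exprS ler_peMr ?(ltW n_pos)// exprn_ege1// ler1n.
apply: (@le_trans _ _ ((2 `^ gamma * K%:R) ^+ 2 *
    \sum_(k < K) 4 * (n%:R * K%:R ^+ 3)^-1)).
  by apply: ler_wpM2l => //; apply: ler_sum => k _; lra.
rewrite sumr_const card_ord -[X in _ * X]mulr_natr.
rewrite (_ : _ * _ = 4 * (2 `^ gamma) ^+ 2 / n%:R); last first.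
  by field; rewrite !gt_eqF.
apply: ler_wpM2l; first by rewrite mulr_ge0 ?sqr_ge0.
by rewrite lef_pV2 ?posrE.
Qed.

Let loss t := (Fbar_gt1 alpha gamma (privatize alpha x w t) - power_sum gamma p) ^+ 2.

(* Outside the event where all errors are below [delta / 2], [tails] is at
   least [1] and the crude bound on the loss is affordable. *)
Let risk_bound (D b : R) (W : T -> R) : 0 <= D -> mean_le P W b ->
  (forall t, (forall k, `|err ord0 t k| <= delta / 2) ->
     (forall k, `|err ord_max t k| <= delta / 2) -> loss t <= D + W t) ->
  (quadratic_risk P (privatize alpha x w) (Fbar_gt1 alpha gamma)
     (power_sum gamma p) <= (D + b + 4 * (2 `^ gamma) ^+ 2 / N)%:E)%E.
Proof.
move=> D0 Wb good; rewrite /quadratic_risk unlock.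
apply: (integral_le_mean _ _ (mean_leD (mean_leD (mean_le_cst P D0) Wb) mean_tails)).
  by move=> t; exact: sqr_ge0.
move=> t; rewrite -/(loss t).
have W0 : 0 <= W t by case: Wb.
have tail1 s k : ~~ (`|err s t k| <= delta / 2) ->
    1 <= tail_bound p alpha (x \o sub s) (w \o sub s) L k t.
  rewrite -ltNge delta_half => /ltW.
  exact: (@tail_bound_ge1 _ _ _ _ _ p alpha (x \o sub s) (w \o sub s)
    alpha01 n0 _ k t (ltW L0)).
have tb0 s k : 0 <= tail_bound p alpha (x \o sub s) (w \o sub s) L k t.
  exact: tail_bound_ge0.
have bad k : ~~ (`|err ord0 t k| <= delta / 2) || ~~ (`|err ord_max t k| <= delta / 2) ->
    loss t <= D + W t + (2 `^ gamma * K%:R) ^+ 2 * tails t.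
  move=> hk; have tails1 : 1 <= tails t.
    apply: (@le_trans _ _ (tail_bound p alpha (x \o sub ord0) (w \o sub ord0) L k t +
      tail_bound p alpha (x \o sub ord_max) (w \o sub ord_max) L k t)).
      case/orP: hk => /tail1 h.
        by rewrite -[leLHS]addr0; exact: lerD.
      by rewrite -[leLHS]add0r; exact: lerD.
    rewrite /tails (bigD1 k)//= lerDl; apply: sumr_ge0 => l _.
    by rewrite addr_ge0.
  apply: (le_trans (thresholded_sum_crude delta gamma1 p_simplex _ _)).
  have := ler_wpM2l (sqr_ge0 (2 `^ gamma * K%:R)) tails1; lra.
have [g1|/existsNP[k /negP h]] :=
    pselect (forall k, `|err ord0 t k| <= delta / 2); last first.
  by apply: (bad k); rewrite h.
have [g2|/existsNP[k /negP h]] :=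
    pselect (forall k, `|err ord_max t k| <= delta / 2); last first.
  by apply: (bad k); rewrite h orbT.
apply: (le_trans (good t g1 g2)).
by rewrite lerDl mulr_ge0 ?sqr_ge0.
Qed.

Let mean_wsum : mean_le P (fun t => \sum_k p k * err ord_max t k ^+ 2)
  (64 * expR 1 / N).
Proof.
have [p01 p1] := p_simplex.
rewrite (_ : 64 * expR 1 / N = \sum_k p k * (64 * expR 1 / N)); last first.
  by rewrite -mulr_suml p1 mul1r.
apply: mean_le_sum => k.
apply: mean_leZ; first by case/andP: (p01 k).
exact: (err_sqr (sub_sample ord_max) p_simplex alpha01 n0 k).
Qed.

Let S := Num.max (K%:R `^ (3 - 2 * gamma)) 1.

(** The exponent [2 * gamma - 2] is at least [1] when [gamma >= 3 / 2], and the sum is then at most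
    that of the [p k]; below, [sum_powR_simplex] gives [2 * K ^ (3 - 2 * gamma)]. *)
Let sum_sqr_powR : \sum_k (p k `^ (gamma - 1)) ^+ 2 <= 2 * S.
Proof.
have [p01 p1] := p_simplex.
have g1 := gamma1.
have -> : \sum_k (p k `^ (gamma - 1)) ^+ 2 = \sum_k p k `^ (2 * gamma - 2).
  apply: eq_bigr => k _; rewrite -(@powR_mulrn _ _ 2) ?powR_ge0// -powRrM.
  by congr (_ `^ _); ring.
have S1 : 1 <= S by rewrite le_max lexx orbT.
have [g32|g32] := leP (3 / 2) gamma.
  apply: (@le_trans _ _ (\sum_k p k)); last by rewrite p1; lra.
  apply: ler_sum => k _; have /andP[pk0 pk1] := p01 k.
  move: pk0; rewrite le_eqVlt => /predU1P[<-|pk0].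
    by rewrite powR0//; lra.
  by apply: ge1r_powR; [rewrite pk0|lra].
apply: (le_trans (sum_powR_simplex K0 p_simplex _)); first lra.
rewrite ler_pM2l// (_ : 1 - _ = 3 - 2 * gamma); last by ring.
by rewrite le_max lexx.
Qed.

Let rate1 := L `^ (gamma - 1) / N `^ (gamma - 1) + N^-1.
Let rate2 := K%:R ^+ 2 * L `^ gamma / N `^ gamma + S / N.
(** The three terms pay for the threshold, the variance of the errors and the event of large
    errors. *)
Let const := 2 * C ^+ 2 * 384 `^ (2 * gamma) + 256 * C ^+ 2 * expR 1
  + 4 * (2 `^ gamma) ^+ 2.

Let CC0 : 0 <= C ^+ 2. Proof. exact: sqr_ge0. Qed.
Let e0 : 0 <= expR 1 :> R. Proof. exact: expR_ge0. Qed.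
Let D0 : 0 <= 384 `^ (2 * gamma) :> R. Proof. exact: powR_ge0. Qed.
Let G0 : 0 <= (2 `^ gamma) ^+ 2 :> R. Proof. exact: sqr_ge0. Qed.

Let risk_rate1 :
  (quadratic_risk P (privatize alpha x w) (Fbar_gt1 alpha gamma)
     (power_sum gamma p) <= (const * rate1)%:E)%E.
Proof.
have CC2 : 0 <= 2 * C ^+ 2 by rewrite mulr_ge0.
apply: (le_trans (risk_bound (D := 2 * C ^+ 2 * (delta ^+ 2) `^ (gamma - 1))
  _ (mean_leZ CC2 mean_wsum) _)).
- by rewrite mulr_ge0 ?powR_ge0.
- by move=> t g1 g2; exact: thresholded_sum_sparse.
rewrite lee_fin.
have h : (delta ^+ 2) `^ (gamma - 1) <= 384 `^ (2 * gamma) * (L `^ (gamma - 1) / N `^ (gamma - 1)).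
  by apply: delta_sqr; have := gamma1; lra.
have := ler_wpM2l CC2 h.
have iN0 : 0 <= N^-1 by rewrite invr_ge0 ltW.
have X0 : 0 <= L `^ (gamma - 1) / N `^ (gamma - 1) by rewrite divr_ge0 ?powR_ge0.
rewrite /const /rate1; move: (C ^+ 2) CC0 => c2 c20.
move: (L `^ (gamma - 1) / N `^ (gamma - 1)) X0 => X X0.
move: (N^-1) iN0 => i i0.
move: (384 `^ (2 * gamma)) D0 => D D00; move: ((2 `^ gamma) ^+ 2) G0 => G G00.
move: (expR 1) e0 => e e00.
have a1 := mulr_ge0 (mulr_ge0 c20 D00) i0.
have a2 := mulr_ge0 (mulr_ge0 c20 e00) i0.
have a3 := mulr_ge0 (mulr_ge0 c20 e00) X0.
have a4 := mulr_ge0 G00 X0.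
lra.
Qed.

Let risk_rate2 :
  (quadratic_risk P (privatize alpha x w) (Fbar_gt1 alpha gamma)
     (power_sum gamma p) <= (const * rate2)%:E)%E.
Proof.
have CC2 : 0 <= 2 * C ^+ 2 by rewrite mulr_ge0.
have S1 : 1 <= S by rewrite le_max lexx orbT.
have iN0 : 0 <= N^-1 by rewrite invr_ge0 ltW.
have eN0 : 0 <= 64 * expR 1 / N by rewrite mulr_ge0// mulr_ge0.
(* Stochastic part of the loss. The factor [2 * S] comes from [sum_sqr_powR] when [gamma < 2]; for
   [gamma >= 2] it is allowed by [S >= 1]. *)
have [W [mW good]] : exists W : T -> R,
    mean_le P W (2 * C ^+ 2 * (64 * expR 1 / N * (2 * S))) /\
    forall t, (forall k, `|err ord0 t k| <= delta / 2) ->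
      (forall k, `|err ord_max t k| <= delta / 2) ->
      loss t <= 2 * C ^+ 2 * K%:R ^+ 2 * (delta ^+ 2) `^ gamma + W t.
  have [g2|g2] := leP 2 gamma.
    exists (fun t => 2 * C ^+ 2 * \sum_k p k * err ord_max t k ^+ 2).
    split; last by move=> t h1 h2; exact: thresholded_sum_dense_ge2.
    have [h1 h2 h3] := mean_leZ CC2 mean_wsum.
    split => //; apply: (le_trans h3); rewrite lee_fin.
    by apply: ler_wpM2l => //; rewrite ler_peMr//; lra.
  exists (fun t => 2 * C ^+ 2 *
    (\sum_k p k `^ (gamma - 1) * err ord_max t k) ^+ 2).
  split; last by move=> t h1 h2; exact: thresholded_sum_dense_lt2.
  have [h1 h2 h3] := mean_leZ CC2 (linear_sqr (sub_sample ord_max) p_simplex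
    alpha01 n0 (fun k => p k `^ (gamma - 1))).
  split => //; apply: (le_trans h3); rewrite lee_fin.
  by apply: ler_wpM2l => //; exact: ler_wpM2l.
apply: (le_trans (risk_bound _ mW good)).
  by rewrite mulr_ge0 ?powR_ge0// mulr_ge0 ?sqr_ge0.
rewrite lee_fin.
have h : (delta ^+ 2) `^ gamma <= 384 `^ (2 * gamma) * (L `^ gamma / N `^ gamma).
  by apply: delta_sqr; have := gamma1; lra.
have CK0 : 0 <= 2 * C ^+ 2 * K%:R ^+ 2 by rewrite mulr_ge0// sqr_ge0.
have := ler_wpM2l CK0 h.
have X0 : 0 <= K%:R ^+ 2 * (L `^ gamma / N `^ gamma).
  by rewrite mulr_ge0 ?sqr_ge0// divr_ge0 ?powR_ge0.
rewrite /const /rate2 -[K%:R ^+ 2 * L `^ gamma / _]mulrA.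
move: (C ^+ 2) CC0 => c2 c20; rewrite -[2 * c2 * K%:R ^+ 2 * _]mulrA.
rewrite [2 * c2 * K%:R ^+ 2 * (384 `^ (2 * gamma) * _)](_ : _ = 2 * c2 * (384 `^ (2 * gamma) *
  (K%:R ^+ 2 * (L `^ gamma / N `^ gamma)))); last by ring.
move: (K%:R ^+ 2 * (delta ^+ 2) `^ gamma) => Y.
move: (K%:R ^+ 2 * (L `^ gamma / N `^ gamma)) X0 => X X0.
move: (N^-1) iN0 => i i0.
move: (384 `^ (2 * gamma)) D0 => D D00; move: ((2 `^ gamma) ^+ 2) G0 => G G00.
move: (expR 1) e0 => e e00; move: S S1 => s s1.
have si0 : 0 <= s * i by rewrite mulr_ge0//; lra.
(* Lets [S / N] absorb the [1 / N] due to the event of large errors. *)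
have sii : 0 <= s * i - i by rewrite -[X in _ - X]mul1r -mulrBl mulr_ge0//; lra.
have a1 := mulr_ge0 (mulr_ge0 c20 D00) si0.
have a2 := mulr_ge0 (mulr_ge0 c20 e00) si0.
have a3 := mulr_ge0 (mulr_ge0 c20 e00) X0.
have a4 := mulr_ge0 G00 X0.
have a5 := mulr_ge0 G00 sii.
lra.
Qed.

Lemma quadratic_risk_gt1 :
  (quadratic_risk P (privatize alpha x w) (Fbar_gt1 alpha gamma)
     (power_sum gamma p) <=
   ((2 * ((1 + gamma) * 4 `^ gamma) ^+ 2 * 384 `^ (2 * gamma)
     + 256 * ((1 + gamma) * 4 `^ gamma) ^+ 2 * expR 1
     + 4 * (2 `^ gamma) ^+ 2) *
    Num.min (L `^ (gamma - 1) / N `^ (gamma - 1) + N^-1)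
      (K%:R ^+ 2 * L `^ gamma / N `^ gamma +
       Num.max (K%:R `^ (3 - 2 * gamma)) 1 / N))%:E)%E.
Proof.
by rewrite -/const /Num.min; case: ifP => _; [exact: risk_rate1|exact: risk_rate2].
Qed.

End linear_regime.

Theorem theorem2p3 (R : realType) (c : R) (hc : 1 <= c) :
  (forall gamma : R, 0 < gamma < 1 ->
    exists2 C : R, 0 < C &
    forall (K n : nat) (alpha : R),
      (0 < K)%N -> (0 < n)%N -> 0 < alpha < 1 -> 1 <= alpha ^+ 2 * n%:R ->
      2 * ln K%:R <= n%:R :> R ->
    forall (d : measure_display) (T : measurableType d)
      (P : ('I_K -> R) -> probability T R)
      (x : 'I_n -> T -> 'I_K) (w : 'I_n -> 'I_K -> T -> R),
      (forall p, prob_simplex R K p -> laplace_sample (P p) p x w) ->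
    (ereal_sup [set quadratic_risk (P p) (privatize alpha x w)
                      (Fbar_lt1 c alpha gamma) (power_sum gamma p)
               | p in prob_simplex R K]
     <= (C * Num.min (K%:R `^ (2 * (1 - gamma)))
                     (K%:R ^+ 2 / (alpha ^+ 2 * n%:R) `^ gamma))%:E)%E)
  /\
  (forall gamma : R, 1 < gamma ->
    exists2 C : R, 0 < C &
    forall (K n : nat) (alpha : R),
      (0 < K)%N -> (0 < n)%N -> 0 < alpha < 1 -> 1 <= alpha ^+ 2 * n%:R ->
      2 * ln K%:R <= n%:R :> R ->
    forall (d : measure_display) (T : measurableType d)
      (P : ('I_K -> R) -> probability T R)
      (x : 'I_2 * 'I_n -> T -> 'I_K) (w : 'I_2 * 'I_n -> 'I_K -> T -> R),
      (forall p, prob_simplex R K p -> laplace_sample (P p) p x w) ->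
    (ereal_sup [set quadratic_risk (P p) (privatize alpha x w)
                      (Fbar_gt1 alpha gamma) (power_sum gamma p)
               | p in prob_simplex R K]
     <= (C * Num.min
          (ln (K * n)%:R `^ (gamma - 1) / (alpha ^+ 2 * n%:R) `^ (gamma - 1)
           + (alpha ^+ 2 * n%:R)^-1)
          (K%:R ^+ 2 * ln (K * n)%:R `^ gamma / (alpha ^+ 2 * n%:R) `^ gamma
           + Num.max (K%:R `^ (3 - 2 * gamma)) 1 / (alpha ^+ 2 * n%:R)))%:E)%E).
Proof.
split=> gamma gammaH.
(* The constant depends on [gamma] and the fixed [c] only, and is chosen before [K], [n] and
   [alpha]. *)
- exists (4 * c `^ (2 * gamma) + 64 * expR 1).
    by rewrite ltr_wpDl ?mulr_gt0 ?expR_gt0// mulr_ge0 ?powR_ge0.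
  move=> K n alpha K0 n0 alpha01 N1 _ d T P x w sample.
  apply: ge_ereal_sup => _ [p p_simplex <-].
  exact: quadratic_risk_lt1 (sample p p_simplex) _ _ _ _ _ _ _.
- exists (2 * ((1 + gamma) * 4 `^ gamma) ^+ 2 * 384 `^ (2 * gamma)
     + 256 * ((1 + gamma) * 4 `^ gamma) ^+ 2 * expR 1
     + 4 * (2 `^ gamma) ^+ 2).
    have := sqr_ge0 ((1 + gamma) * 4 `^ gamma); move: (_ ^+ 2) => C2 C20.
    have a1 := mulr_ge0 C20 (powR_ge0 384 (2 * gamma)).
    have a2 := mulr_ge0 C20 (expR_ge0 (1 : R)).
    have a3 : 0 < (2 `^ gamma) ^+ 2 :> R by rewrite exprn_gt0 ?powR_gt0.
    by move: a1 a2 a3; lra.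
  move=> K n alpha K0 n0 alpha01 N1 lnK d T P x w sample.
  apply: ge_ereal_sup => _ [p p_simplex <-].
  exact: quadratic_risk_gt1 (sample p p_simplex) _ _ _ _ _ _ _.
Qed.
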